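(* Let $f:N\to N$ be a local $C^\infty$ diffeomorphism of a sub-Riemannian manifold $N$ preserving the horizontal distribution $E$. Assume that $E$ is generic at a point $p\in N$ with $f(p)=p$. Suppose the tangent cone $TC_pN$ is $(r+1)$-step, and set $n_{-1}=0$ and $n_i=\dim E^i(p)$ for $i\in\{0,\dots,r\}$. Suppose that for each $i$ the map $D_pf|_{E^i_p}$ has Lyapunov exponents $$(\log\lambda_1,\dots,\log\lambda_{n_0},\log\lambda_{n_0+1},\dots,\log\lambda_{n_1},\dots,\log\lambda_{n_i})$$ listed with multiplicity, and with $\log\lambda_{n_{j-1}+1},\dots,\log\lambda_{n_j}$ in nondecreasing order for each $j\in\{0,\dots,i\}$. Then for each $i\in\{0,\dots,r\}$ and each $j\in\{n_{i-1}+1,\dots,n_i\}$, $$(i+1)\log\lambda_1\le \log\lambda_j\le (i+1)\log\lambda_{n_0}.$$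
   Context: A sub-Riemannian manifold is a smooth manifold $N$ with a smooth distribution $E\subset TN$ (the horizontal distribution) satisfying Hörmander's condition (vector fields tangent to $E$ together with their iterated brackets generate $TN$), and a smooth Riemannian inner product on $E$. The Carnot-Carathéodory distance $d_C(x,y)$ is the infimum of lengths of curves tangent to $E$ joining $x$ to $y$. ''$f$ preserves $E$'' means $Df(E)=E$. For $i\ge 0$, $E^i(x)=E^i_x\subset T_xN$ is the span at $x$ of all iterated brackets, with at most $i$ bracket operations, of vector fields tangent to $E$ (so $E^0=E$). $E$ is generic (of order $r$) at $p$ if on a neighborhood $U$ of $p$ the $E^i_x$ form a strictly increasing sequence of smooth subbundles $E=E^0\subset E^1\subset\dots\subset E^r=TU$. At a generic point $p$, the tangent cone $TC_pN$, i.e. the pointed Gromov-Hausdorff limit of $(N,p,t\,d_C)$ as $t\to\infty$, exists, is unique, and is a Carnot nilpotent Lie group with Lie algebra $\mathfrak n=\bigoplus_{i=0}^r\mathfrak n^i$, $\mathfrak n^{i+1}=[\mathfrak n^i,\mathfrak n^0]$, $\dim\mathfrak n^i=\dim E^i(p)-\dim E^{i-1}(p)$; it is $(r+1)$-step when $E$ is generic of order $r$. At a fixed point $p$, the Lyapunov exponents of $D_pf$ (or of its restriction to an invariant subspace) are the logarithms of the absolute values of its eigenvalues. The list is compatible with the filtration: for each $i$, the first $n_i$ entries are the exponents of $D_pf|_{E^i_p}$. *)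

(* Defs.v *)
From HB Require Import structures.
From mathcomp Require Import all_boot all_order all_algebra.
From mathcomp Require Import complex.
From mathcomp Require Import all_classical all_reals all_analysis.
Set Implicit Arguments.
Unset Strict Implicit.
Unset Printing Implicit Defensive.
Import Order.TTheory GRing.Theory Num.Theory.
Import numFieldNormedType.Exports.
Local Open Scope classical_set_scope.
Local Open Scope ring_scope.

(* The span of an arbitrary (possibly infinite) set of vectors, as the unique
   subspace consisting of the finite linear combinations: see [set_spanP]. *)
Definition set_span (K : fieldType) (V : vectType K) (S : set V) : {vspace V} :=
  xget 0%VS [set W : {vspace V} | forall v, v \in W <->
    exists2 s : seq V, (forall u, u \in s -> S u) & v \in span s].

Lemma set_spanP (K : fieldType) (V : vectType K) (S : set V) (v : V) :
  v \in set_span S <->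
  exists2 s : seq V, (forall u, u \in s -> S u) & v \in span s.
Proof.
pose P d := `[< exists2 s : seq V, (forall u, u \in s -> S u) & \dim (span s) = d >].
have P0 : exists d, P d by exists 0%N; apply/asboolP; exists [::] => //; rewrite span_nil dimv0.
have Pb d : P d -> (d <= \dim {:V})%N.
  by move=> /asboolP[s _ <-]; apply: dimvS; apply: subvf.
case: (ex_maxnP P0 Pb) => d /asboolP[s sS ds] dmax.
rewrite /set_span; case: xgetP => [W _ ->//|/(_ (span s))[]] w.
split=> [ws|[t tS wt]]; first by exists s.
have st : (span s <= span (s ++ t))%VS by apply: sub_span => u us; rewrite mem_cat us.
have /eqP -> : (span s == span (s ++ t))%VS.
  rewrite eqEdim st /= ds; apply: dmax; apply/asboolP; exists (s ++ t) => // u.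
  by rewrite mem_cat => /orP[/sS|/tS].
by apply: (subvP (sub_span _)) wt => u ut; rewrite mem_cat ut orbT.
Qed.

(* The matrix of the restriction of [A] to [U]; meaningful when [A] maps [U]
   into itself. *)
Definition restriction_mx (K : fieldType) (V : vectType K) (U : {vspace V})
    (A : 'End(V)) : 'M[K]_(\dim U) :=
  \matrix_(i, j) coord (vbasis U) j (A (vbasis U)`_i).

(* The eigenvalues are complex and counted with algebraic multiplicity. *)
Definition lyapunov_exponents (R : realType) (V : vectType R)
    (U : {vspace V}) (A : 'End(V)) (s : seq R) : Prop :=
  exists2 mu : seq R[i],
    map_poly (real_complex R) (char_poly (restriction_mx U A)) =
      \prod_(z <- mu) ('X - z%:P) &
    perm_eq s [seq ln (Normc.normc z) | z <- mu].

Fixpoint Ck_on (R : realType) (V W : normedModType R) (k : nat)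
    (U : set V) (f : V -> W) : Prop :=
  match k with
  | 0%N => forall x, U x -> {for x, continuous f}
  | k'.+1 => (forall x, U x -> differentiable f x) /\
             forall v, Ck_on k' U (fun x => 'D_v f x)
  end.

(* Used for open [U] only. *)
Definition smooth_on (R : realType) (V W : normedModType R)
    (U : set V) (f : V -> W) : Prop := forall k, Ck_on k U f.

(* The values of [fwd] outside [dom], and of [bwd] outside [fwd @` dom], are
   irrelevant. *)
Record chart (R : realType) (n : nat) (M : topologicalType) := Chart {
  dom : set M;
  fwd : M -> 'rV[R]_n;
  bwd : 'rV[R]_n -> M }.

Definition chart_axiom (R : realType) (n : nat) (M : topologicalType)
    (c : chart R n M) : Prop :=
  [/\ open (dom c), open (fwd c @` dom c),
      forall x, dom c x -> bwd c (fwd c x) = x,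
      forall x, dom c x -> {for x, continuous (fwd c)} &
      forall y, (fwd c @` dom c) y -> {for y, continuous (bwd c)}].

(* The tangent space at [x] is represented by ['rV[R]_n], a tangent vector being
   read in the chart [chart_at x]; this is the only use of [chart_at]. *)
Record manifold (R : realType) (n : nat) := Manifold {
  points :> topologicalType;
  manifold_hausdorff : hausdorff_space points;
  manifold_second_countable : @second_countable points;
  atlas : set (chart R n points);
  atlas_chart : forall c, atlas c -> chart_axiom c;
  atlas_compatible : forall c d, atlas c -> atlas d ->
    smooth_on (fwd c @` (dom c `&` dom d)) (fwd d \o bwd c);
  chart_at : points -> chart R n points;
  chart_at_atlas : forall x, atlas (chart_at x);
  dom_chart_at : forall x, dom (chart_at x) x }.

(* Used for open [U] only. *)
Definition smooth_map (R : realType) (m n : nat) (M : manifold R m)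
    (N : manifold R n) (U : set M) (f : M -> N) : Prop :=
  (forall x, U x -> {for x, continuous f}) /\
  forall c d, @atlas _ _ M c -> @atlas _ _ N d ->
    smooth_on (fwd c @` (dom c `&` U `&` f @^-1` dom d)) (fwd d \o f \o bwd c).

Definition smooth_function (R : realType) (n : nat) (M : manifold R n)
    (U : set M) (h : M -> R) : Prop :=
  forall c, @atlas _ _ M c ->
    smooth_on (fwd c @` (dom c `&` U)) (h \o bwd c : 'rV[R]_n -> R^o).

Definition local_diffeomorphism (R : realType) (m n : nat) (M : manifold R m)
    (N : manifold R n) (f : M -> N) : Prop :=
  forall x, exists (U : set M) (g : N -> M),
    [/\ open U /\ U x, open (f @` U), smooth_map U f, smooth_map (f @` U) g &
        forall y, U y -> g (f y) = y].

(* The differential [T_x M -> T_(f x) N]. *)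
Definition tangent_map (R : realType) (m n : nat) (M : manifold R m)
    (N : manifold R n) (f : M -> N) (x : M) : 'Hom('rV[R]_m, 'rV[R]_n) :=
  linfun ('d (fwd (chart_at (f x)) \o f \o bwd (chart_at x))
             (fwd (chart_at x) x)).

(* The field [X] read in the chart [c]. *)
Definition field_in (R : realType) (n : nat) (M : manifold R n)
    (c : chart R n M) (X : M -> 'rV[R]_n) (y : 'rV[R]_n) : 'rV[R]_n :=
  let x := bwd c y in
  'd (fwd c \o bwd (chart_at x)) (fwd (chart_at x) x) (X x).

Definition smooth_field (R : realType) (n : nat) (M : manifold R n)
    (U : set M) (X : M -> 'rV[R]_n) : Prop :=
  forall c, @atlas _ _ M c ->
    smooth_on (fwd c @` (dom c `&` U)) (field_in c X).

Definition lie_bracket (R : realType) (n : nat) (M : manifold R n)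
    (X Y : M -> 'rV[R]_n) (x : M) : 'rV[R]_n :=
  let c := chart_at x in let y := fwd c x in
  'd (field_in c Y) y (field_in c X y) - 'd (field_in c X) y (field_in c Y y).

Definition smooth_subbundle (R : realType) (n : nat) (M : manifold R n)
    (U : set M) (F : M -> {vspace 'rV[R]_n}) : Prop :=
  forall x, U x -> exists (V : set M) (k : nat) (X : 'I_k -> M -> 'rV[R]_n),
    [/\ open V, V x, forall i, smooth_field V (X i) &
        forall y, V y -> basis_of (F y) [seq X i y | i : 'I_k]].

Definition tangent_field (R : realType) (n : nat) (M : manifold R n)
    (E : M -> {vspace 'rV[R]_n}) (U : set M) (X : M -> 'rV[R]_n) : Prop :=
  smooth_field U X /\ forall x, U x -> X x \in E x.

(* [iterated_bracket E U k X]: on the open set [U], [X] is an iterated bracket,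
   with [k] bracket operations, of vector fields on [U] tangent to [E]. *)
Inductive iterated_bracket (R : realType) (n : nat) (M : manifold R n)
    (E : M -> {vspace 'rV[R]_n}) (U : set M) : nat -> (M -> 'rV[R]_n) -> Prop :=
| iterated_bracket0 X : tangent_field E U X -> iterated_bracket E U 0 X
| iterated_bracketS i j X Y :
    iterated_bracket E U i X -> iterated_bracket E U j Y ->
    iterated_bracket E U (i + j).+1 (lie_bracket X Y).

(* The space [E^i_x]. *)
Definition flag (R : realType) (n : nat) (M : manifold R n)
    (E : M -> {vspace 'rV[R]_n}) (i : nat) (x : M) : {vspace 'rV[R]_n} :=
  set_span [set v | exists (U : set M) (k : nat) (X : M -> 'rV[R]_n),
    [/\ open U, U x, (k <= i)%N, iterated_bracket E U k X & v = X x]].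

Definition generic_at (R : realType) (n : nat) (M : manifold R n)
    (E : M -> {vspace 'rV[R]_n}) (r : nat) (p : M) : Prop :=
  exists U : set M,
    [/\ open U, U p,
        forall i, (i <= r)%N -> smooth_subbundle U (flag E i),
        forall i x, (i < r)%N -> U x ->
          (flag E i x <= flag E i.+1 x)%VS /\ flag E i x <> flag E i.+1 x &
        forall x, U x -> flag E r x = fullv].

(* Only the values of [metric x] on [horizontal x] are relevant. *)
Record subRiemannian (R : realType) (n : nat) := SubRiemannian {
  sr_manifold :> manifold R n;
  horizontal : sr_manifold -> {vspace 'rV[R]_n};
  horizontal_smooth : smooth_subbundle setT horizontal;
  hormander : forall x, exists i, flag horizontal i x = fullv;
  metric : sr_manifold -> 'rV[R]_n -> 'rV[R]_n -> R;
  metric_sym : forall x, {in horizontal x &, forall u v,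
    metric x u v = metric x v u};
  metric_linear : forall x (a : R), {in horizontal x & &, forall u v w,
    metric x (a *: u + v) w = a * metric x u w + metric x v w};
  metric_pos : forall x, {in horizontal x, forall u,
    u != 0 -> 0 < metric x u u};
  metric_smooth : forall (U : set sr_manifold) X Y, open U ->
    tangent_field horizontal U X -> tangent_field horizontal U Y ->
    smooth_function U (fun x => metric x (X x) (Y x)) }.

Definition preserves_horizontal (R : realType) (n : nat)
    (N : subRiemannian R n) (f : N -> N) : Prop :=
  forall x, (tangent_map f x @: horizontal x)%VS = horizontal (f x).

Definition velocity (R : realType) (n : nat) (M : manifold R n)
    (gamma : R -> M) (t : R) : 'rV[R]_n :=
  derive1 (fwd (chart_at (gamma t)) \o gamma) t.

(* [gamma] is, on [0, 1], a C^1 curve tangent to the horizontal distribution. *)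
Definition horizontal_arc (R : realType) (n : nat) (N : subRiemannian R n)
    (gamma : R -> N) : Prop :=
  (exists J : set R,
    [/\ open J, `[0, 1] `<=` J,
        forall t, J t -> {for t, continuous gamma} &
        forall c, @atlas _ _ N c ->
          Ck_on 1 (J `&` gamma @^-1` dom c : set R^o) (fwd c \o gamma)]) /\
  forall t, 0 <= t <= 1 -> velocity gamma t \in horizontal (gamma t).

Definition arc_length (R : realType) (n : nat) (N : subRiemannian R n)
    (gamma : R -> N) : R :=
  \int[lebesgue_measure]_(t in `[0, 1])
    Num.sqrt (metric (gamma t) (velocity gamma t) (velocity gamma t)).

(* [joined x y l]: a piecewise C^1 horizontal curve of length [l] joins [x] to
   [y]. *)
Inductive joined (R : realType) (n : nat) (N : subRiemannian R n) (x : N) :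
    N -> R -> Prop :=
| joined_refl : joined x x 0
| joined_arc y l (gamma : R -> N) :
    joined x y l -> horizontal_arc gamma -> gamma 0 = y ->
    joined x (gamma 1) (l + arc_length gamma).

Definition cc_dist (R : realType) (n : nat) (N : subRiemannian R n) (x y : N) :
    \bar R :=
  ereal_inf [set l%:E | l in joined x y].

Definition simply_connected (R : realType) (T : topologicalType) : Prop :=
  (forall x y : T, exists gamma : R -> T,
    [/\ continuous gamma, gamma 0 = x & gamma 1 = y]) /\
  forall gamma : R -> T, continuous gamma -> gamma 0 = gamma 1 ->
    exists H : R * R -> T, continuous H /\ forall t, 0 <= t <= 1 ->
      [/\ H (0, t) = gamma t, H (1, t) = gamma 0,
          H (t, 0) = gamma 0 & H (t, 1) = gamma 0].

Definition lie_group (R : realType) (n : nat) (G : manifold R n)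
    (mul : G -> G -> G) (inv : G -> G) (e : G) : Prop :=
  [/\ [/\ associative mul, left_id e mul & left_inverse e inv mul],
      continuous (fun z : G * G => mul z.1 z.2),
      forall a b c, @atlas _ _ G a -> @atlas _ _ G b -> @atlas _ _ G c ->
        smooth_on
          [set z | (fwd a @` dom a) z.1 /\ (fwd b @` dom b) z.2 /\
                   dom c (mul (bwd a z.1) (bwd b z.2))]
          (fun z : 'rV[R]_n * 'rV[R]_n =>
             fwd c (mul (bwd a z.1) (bwd b z.2))) &
      smooth_map setT inv].

Definition left_invariant_field (R : realType) (n : nat) (G : manifold R n)
    (mul : G -> G -> G) (e : G) (u : 'rV[R]_n) : G -> 'rV[R]_n :=
  fun x => tangent_map (mul x) e u.

(* A Carnot group of step [s] with its left-invariant sub-Riemannian structure: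
   [layer 0], ..., [layer s.-1] is the stratification of the Lie algebra of [G],
   identified with the tangent space at [e]. *)
Definition carnot_group (R : realType) (n : nat) (G : subRiemannian R n)
    (mul : G -> G -> G) (inv : G -> G) (e : G) (s : nat) : Prop :=
  [/\ lie_group mul inv e, simply_connected R G,
      forall a x : G, (tangent_map (mul a) x @: horizontal x)%VS =
        horizontal (mul a x),
      forall a x : G, {in horizontal x &, forall u v,
        metric (mul a x) (tangent_map (mul a) x u) (tangent_map (mul a) x v) =
        metric x u v} &
      exists layer : nat -> {vspace 'rV[R]_n},
        [/\ layer 0%N = horizontal e,
            forall i, layer i.+1 =
              set_span [set w | exists u v, [/\ u \in layer i, v \in layer 0%N &
                w = lie_bracket (left_invariant_field mul e u)
                                (left_invariant_field mul e v) e]],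
            directv (\sum_(i < s) layer i),
            (\sum_(i < s) layer i)%VS = fullv &
            [/\ (0 < s)%N, layer s.-1 <> 0%VS & layer s = 0%VS]]].

(* [(X, o, dX)] is the pointed Gromov-Hausdorff limit of [(N, p, t d_C)] as [t]
   tends to infinity: for large [t] there is an [eps]-approximation from the
   ball of radius [rho] at [p] into [X]. *)
Definition pointed_GH_limit (R : realType) (n : nat) (N : subRiemannian R n)
    (p : N) (X : Type) (o : X) (dX : X -> X -> \bar R) : Prop :=
  forall rho eps : R, 0 < rho -> 0 < eps -> exists T : R, forall t, T <= t ->
    let d x y := (t%:E * cc_dist x y)%E in
    exists h : N -> X,
      [/\ h p = o,
          forall x y, (d p x < rho%:E)%E -> (d p y < rho%:E)%E ->
            (`|d x y - dX (h x) (h y)| < eps%:E)%E &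
          forall z, (dX o z < (rho - eps)%:E)%E ->
            exists2 x, (d p x < rho%:E)%E & (dX (h x) z < eps%:E)%E].

Definition tangent_cone_step (R : realType) (n : nat) (N : subRiemannian R n)
    (p : N) (s : nat) : Prop :=
  exists (m : nat) (G : subRiemannian R m) (mul : G -> G -> G) (inv : G -> G)
    (e : G), carnot_group mul inv e s /\ pointed_GH_limit p e (@cc_dist _ _ G).

(* [flag_dim p i.+1] is [n_i], and [flag_dim p 0] is [n_(-1)]. *)
Definition flag_dim (R : realType) (n : nat) (N : subRiemannian R n) (p : N)
    (i : nat) : nat :=
  if i is k.+1 then \dim (flag (@horizontal _ _ N) k p) else 0.

(* Main.v *)
(* On a neighborhood of [p] the bracket of a section of [E^i] and a section of
   [E^j] is a section of [E^(i+j+1)]; modulo [E^(i+j)] its value at [p] depends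
   only on the values at [p] of the two sections modulo [E^(i-1)] and [E^(j-1)],
   because a section of the bundle [E^i] which vanishes at [p] has its derivative
   at [p] in [E^i_p].  Brackets are natural, so [A = D_p f] acts on the resulting
   graded Lie algebra.  If [z] is an eigenvalue of [A] on [E^(k+1)_p / E^k_p],
   compose the bracket with an eigencovector: for some [i + j = k] this gives a
   nonzero bilinear form [B] on [gr^i x gr^j] with [B(Au, Av) = z B(u, v)], so
   that [z] is the product of an eigenvalue on [gr^i] and one on [gr^j].  By
   strong induction [z] is a product of [k+2] eigenvalues on [E_p]. *)
Require Import Defs.
From HB Require Import structures.
From mathcomp Require Import all_boot all_order all_algebra.
From mathcomp Require Import complex.
From mathcomp Require Import all_classical all_reals all_analysis.
Set Implicit Arguments.
Unset Strict Implicit.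
Unset Printing Implicit Defensive.
Import Order.TTheory GRing.Theory Num.Theory.
Import numFieldNormedType.Exports.
Local Open Scope classical_set_scope.
Local Open Scope ring_scope.

(** * Differential calculus on normed spaces *)

(** The graded pieces are never formed. The bracket is carried by bilinear maps defined on the whole
    tangent space and correct only modulo the flag, and an eigenvalue on a graded piece by a complex
    covector on E^i_p that vanishes on E^(i-1)_p. Covectors are the right side to work on: the
    brackets span E^(k+1)_p modulo E^k_p, so a nonzero covector of the quotient cannot kill them
    all, and the errors modulo E^k_p become zero once it is applied.

    The analytic obstacle is that a bracket involves first derivatives, whereas lifts of vectors to
    sections are arbitrary. For a section vanishing at [p], the difference quotients lie in the
    spans of a local frame that tends to a free family, and lying in a row space of constant full
    rank is a closed condition.

    The algebraic step is the matrix equation [M1 B M2^T = z B]; it splits [z] as a product only if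
    the second factor [beta] is nonzero. This comes from Df(E) = E at the fixed point: no eigenvalue
    on E_p is zero, and the property propagates to the products. *)

Lemma near_differentiable (R : realType) (V W : normedModType R)
    (f g : V -> W) (x : V) :
  (\near x, f x = g x) -> differentiable f x ->
  differentiable g x /\ 'd g x = 'd f x :> (V -> W).
Proof.
move=> fg fx.
have [dc df] := (diff_locallyP _ _).1 fx.
have gd : g \o shift x = cst (g x) + 'd f x +o_ 0 id.
  apply/eqaddoP => e e0; have /eqaddoP/(_ e e0) := df.
  have fg0 : \forall h \near 0, f (h + x) = g (h + x).
    have : \forall h \near x, f h = g h by [].
    by rewrite (near_shift 0) subr0.
  move=> H; near=> h.
  have -> : (g \o shift x - (cst (g x) + 'd f x)) h =
            (f \o shift x - (cst (f x) + 'd f x)) h.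
    rewrite -![(_ - _ : _ -> _) _]/(_ - _) /= -![(_ + _ : _ -> _) _]/(_ + _).
    by rewrite /cst -(nbhs_singleton fg) -(near fg0 h).
  by near: h.
have E := diff_unique dc gd.
by split; [apply/diff_locallyP; rewrite E|].
Unshelve. all: by end_near. Qed.

Lemma scale_is_bilinear (R : realType) (W : normedModType R) :
  bilinear_for
    (GRing.Scale.Law.clone _ _ *:%R _) (GRing.Scale.Law.clone _ _ *:%R _)
    (fun (k : R^o) (w : W) => k *: w).
Proof.
split=> [u'|u] a x y /=.
- by rewrite scalerDl scalerA.
- by rewrite scalerDr !scalerA mulrC.
Qed.

Lemma is_diff_scale (R : realType) (V W : normedModType R) (k : V -> R^o)
    (f : V -> W) (x : V) :
  differentiable k x -> differentiable f x ->
  is_diff x (fun y => k y *: f y) (fun v => k x *: 'd f x v + 'd k x v *: f x).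
Proof.
move=> dk df.
pose m := bilinear_isBilinear.Build R R^o W W _ _ _ (scale_is_bilinear W).
pose b : {bilinear R^o -> W -> W} := HB.pack (fun (k : R^o) (w : W) => k *: w) m.
have cb : continuous (fun p : R^o * W => b p.1 p.2).
  by move=> p; apply: (@scale_continuous R W p).
have dp := differentiable_pair dk df.
have e : (fun y => k y *: f y) =
         (fun p : R^o * W => b p.1 p.2) \o (fun y => (k y, f y)) by [].
rewrite e; apply: DiffDef.
  by apply: differentiable_comp => //; apply: differentiable_bilin.
rewrite diff_comp //; last exact: differentiable_bilin.
by rewrite diff_bilin // diff_pair.
Qed.

Lemma Ck_on_sub (R : realType) (V W : normedModType R) k (U U' : set V)
    (f : V -> W) : U' `<=` U -> Ck_on k U f -> Ck_on k U' f.
Proof.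
move=> UU'; elim: k f => [|k IH] f /=; first by move=> H x /UU'/H.
by case=> d H; split=> [x /UU'/d//|v]; apply: IH.
Qed.

Lemma Ck_on_le (R : realType) (V W : normedModType R) k (U : set V)
    (f : V -> W) : Ck_on k.+1 U f -> Ck_on k U f.
Proof.
elim: k f => [|k IH] f /=; first by case=> d _ x /d /differentiable_continuous.
by case=> d H; split=> // v; apply: IH; apply: H.
Qed.

(** [Ck_on] only constrains the germ of [f] at each point of [U], so it can be checked on a cover.
    This lets the chart vary from point to point. *)
Lemma Ck_on_local (R : realType) (V W : normedModType R) k (U : set V)
    (f : V -> W) :
  (forall x, U x -> exists2 U' : set V, U' x & Ck_on k U' f) -> Ck_on k U f.
Proof.
elim: k f => [|k IH] f /= H; first by move=> x /H[U' U'x]; apply.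
split=> [x /H[U' U'x [d _]]|v]; first exact: d.
by apply: IH => x /H[U' U'x [_ H']]; exists U'.
Qed.

Lemma Ck_on_eq (R : realType) (V W : normedModType R) k (U : set V)
    (f g : V -> W) : open U -> (forall x, U x -> f x = g x) ->
  Ck_on k U f -> Ck_on k U g.
Proof.
move=> Uo; elim: k f g => [|k IH] f g fg.
  move=> /= H x Ux; have : \near x, f x = g x.
    by near=> y; apply: fg; near: y; apply: open_nbhs_nbhs.
  by move=> n; rewrite /prop_for /continuous_at -fg //;
    apply: (cvg_trans (near_eq_cvg n)); exact: H.
have n x : U x -> \near x, f x = g x.
  by move=> Ux; near=> y; apply: fg; near: y; apply: open_nbhs_nbhs.
case=> d H; split=> [x Ux|v]; first by case: (near_differentiable (n x Ux) (d x Ux)).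
apply: IH (H v) => x Ux; apply: near_eq_derive; exact: n.
Unshelve. all: by end_near. Qed.

Lemma Ck_on_cst (R : realType) (V W : normedModType R) k (U : set V) (a : W) :
  Ck_on k U (cst a : V -> W).
Proof.
elim: k a => [|k IH] a /=; first by move=> x _; apply: cst_continuous.
split=> [x _|v]; first exact: differentiable_cst.
have -> : (fun x => 'D_v (cst a) x) = cst 0.
  by apply/funext => x; rewrite derive_cst.
exact: IH.
Qed.

Lemma Ck_on_linear (R : realType) (V W W' : normedModType R) k (U : set V)
    (f : V -> W) (L : {linear W -> W'}) : open U -> continuous L ->
  Ck_on k U f -> Ck_on k U (L \o f).
Proof.
move=> Uo Lc; elim: k f => [|k IH] f /=.
  by move=> H x Ux; apply: continuous_comp; [exact: H|exact: Lc].
case=> d H; split=> [x Ux|v].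
  by apply: differentiable_comp; [exact: d|exact: linear_differentiable].
apply: Ck_on_eq (IH _ (H v)) => // x Ux.
have dL : differentiable L (f x) by apply: linear_differentiable.
rewrite /= deriveE; last exact: d.
rewrite deriveE; last by apply: differentiable_comp => //; exact: d.
by rewrite (diff_comp (d _ Ux) dL) /= diff_lin.
Qed.

Lemma Ck_onD (R : realType) (V W : normedModType R) k (U : set V)
    (f g : V -> W) : open U -> Ck_on k U f -> Ck_on k U g ->
  Ck_on k U (fun x => f x + g x).
Proof.
move=> Uo; elim: k f g => [|k IH] f g /=.
  move=> H K x Ux; apply: continuousD; [exact: H|exact: K].
move=> [d H] [e K]; split=> [x Ux|v].
  by apply: differentiableD; [exact: d|exact: e].
apply: Ck_on_eq (IH _ _ (H v) (K v)) => // x Ux.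
by rewrite deriveD //; apply: diff_derivable; [exact: d|exact: e].
Qed.

Lemma Ck_on_scale (R : realType) (V W : normedModType R) k (U : set V)
    (h : V -> R^o) (f : V -> W) : open U -> Ck_on k U h -> Ck_on k U f ->
  Ck_on k U (fun x => h x *: f x).
Proof.
move=> Uo; elim: k h f => [|k IH] h f.
  move=> /= H K x Ux; have := cvgZ (H x Ux) (K x Ux); exact.
move=> [d H] [e K]; split=> [x Ux|v].
  by have [] := is_diff_scale (d _ Ux) (e _ Ux).
have C1 := IH _ _ (Ck_on_le (conj d H)) (K v).
have C2 := IH _ _ (H v) (Ck_on_le (conj e K)).
apply: Ck_on_eq (Ck_onD Uo C1 C2) => // x Ux.
have [D E] := is_diff_scale (d _ Ux) (e _ Ux).
by rewrite [RHS]deriveE // E deriveE; [rewrite deriveE //; apply: d|apply: e].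
Qed.

Lemma Ck_on_sum (R : realType) (V W : normedModType R) k (U : set V)
    (I : Type) (s : seq I) (f : I -> V -> W) :
  open U -> (forall i, Ck_on k U (f i)) ->
  Ck_on k U (fun x => \sum_(i <- s) f i x).
Proof.
move=> Uo H; elim: s => [|i s IH].
  by apply: Ck_on_eq (Ck_on_cst k U 0) => // x Ux; rewrite big_nil.
by apply: Ck_on_eq (Ck_onD Uo (H i) IH) => // x Ux; rewrite big_cons.
Qed.

Lemma diff_rV_sum (R : realType) n (W : normedModType R)
    (f : 'rV[R]_n -> W) (x v : 'rV[R]_n) :
  'd f x v = \sum_i v 0 i *: 'd f x (delta_mx 0 i).
Proof.
rewrite {1}(row_sum_delta v) linear_sum; apply: eq_bigr => i _; exact: linearZ.
Qed.

Lemma continuous_coord (R : realType) n (i : 'I_n) :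
  continuous (fun v : 'rV[R]_n => v 0 i : R^o).
Proof. by move=> v; apply: coord_continuous. Qed.

Lemma coord_is_linear (R : realType) n (i : 'I_n) :
  linear (fun v : 'rV[R]_n => v 0 i : R^o).
Proof. by move=> a u v; rewrite !mxE. Qed.

Lemma Ck_on_coord (R : realType) (V : normedModType R) n k (U : set V)
    (f : V -> 'rV[R]_n) (i : 'I_n) : open U -> Ck_on k U f ->
  Ck_on k U (fun x => f x 0 i : R^o).
Proof.
move=> Uo.
pose m := GRing.isLinear.Build R 'rV[R]_n R^o _ _ (@coord_is_linear R n i).
pose L : {linear 'rV[R]_n -> R^o} := HB.pack (fun v : 'rV[R]_n => v 0 i : R^o) m.
exact: (Ck_on_linear (L := L) Uo (@continuous_coord R n i)).
Qed.

(** [Ck_on] differentiates along one fixed vector at a time, while the chain rule produces ['d f]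
    along a direction that varies with the point. Expanding this direction in coordinates of the
    middle space ['rV[R]_n] gives a sum of products, to which the induction applies. *)
Lemma Ck_on_comp (R : realType) (V W : normedModType R) n k (U : set V)
    (O : set 'rV[R]_n) (g : V -> 'rV[R]_n) (f : 'rV[R]_n -> W) :
  open U -> open O -> (forall x, U x -> O (g x)) ->
  Ck_on k U g -> Ck_on k O f -> Ck_on k U (f \o g).
Proof.
move=> Uo Oo gO; elim: k f => [|k IH] f.
  move=> /= H K x Ux; apply: continuous_comp; [exact: H|exact/K/gO].
move=> [d H] [e K]; split=> [x Ux|v].
  by apply: differentiable_comp; [exact: d|exact/e/gO].
have C i : Ck_on k U (fun x => 'D_v g x 0 i *: 'D_(delta_mx 0 i) f (g x)).
  apply: (Ck_on_scale Uo (Ck_on_coord i Uo (H v))).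
  exact: (IH _ (Ck_on_le (conj d H)) (K _)).
apply: Ck_on_eq (Ck_on_sum (index_enum 'I_n) Uo C) => // x Ux.
have dx := d _ Ux; have ex := e _ (gO _ Ux).
rewrite [RHS]deriveE; last exact: differentiable_comp.
rewrite (diff_comp dx ex) /= [RHS]diff_rV_sum deriveE //.
by apply: eq_bigr => i _; rewrite deriveE.
Qed.

Lemma Ck_on_diff (R : realType) (V W : normedModType R) n k (U : set V)
    (O : set 'rV[R]_n) (g h : V -> 'rV[R]_n) (f : 'rV[R]_n -> W) :
  open U -> open O -> (forall x, U x -> O (g x)) ->
  Ck_on k U g -> Ck_on k U h -> Ck_on k.+1 O f ->
  Ck_on k U (fun x => 'd f (g x) (h x)).
Proof.
move=> Uo Oo gO Cg Ch [e K].
have C i : Ck_on k U (fun x => h x 0 i *: 'D_(delta_mx 0 i) f (g x)).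
  apply: (Ck_on_scale Uo (Ck_on_coord i Uo Ch)).
  exact: (Ck_on_comp Uo Oo gO Cg (K _)).
apply: Ck_on_eq (Ck_on_sum (index_enum 'I_n) Uo C) => // x Ux.
rewrite [RHS]diff_rV_sum; apply: eq_bigr => i _.
by rewrite deriveE //; exact/e/gO.
Qed.

(** * Symmetry of second derivatives *)

Lemma MVT_dir (R : realType) (V : normedModType R) (f : V -> R^o) (x u : V)
    (t : R) : 0 < t ->
  (forall s, 0 <= s <= t -> differentiable f (x + s *: u)) ->
  exists2 s, 0 < s < t & f (x + t *: u) - f x = t * 'D_u f (x + s *: u).
Proof.
move=> t0 df.
pose L (s : R^o) : V := x + s *: u.
have dL s : is_diff s L ( *:%R ^~ u).
  by apply: is_diff_eq; rewrite add0r.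
pose h : R^o -> R^o := f \o L.
have dh s : 0 <= s <= t -> is_diff s h (fun k : R^o => k *: 'D_u f (x + s *: u)).
  move=> st; have dfs := df _ st.
  apply: DiffDef; first by apply: differentiable_comp.
  rewrite diff_comp // diff_val; apply/funext => k /=.
  by rewrite linearZ deriveE.
have [||c ct E] := @MVT R h (fun s => 'D_u f (x + s *: u)) 0 t t0.
- move=> s; rewrite in_itv /= => /andP[s0 st].
  have st' : 0 <= s <= t by rewrite !ltW.
  have [D E] := dh s st'.
  by apply: DeriveDef; [exact: diff_derivable|rewrite deriveE // E scale1r].
- apply: continuous_in_subspaceT => s; rewrite inE /= in_itv /= => st.
  by have [D _] := dh s st; apply: differentiable_continuous.
exists c; first by move: ct; rewrite in_itv.
by move: E; rewrite /h /L /= scale0r addr0 subr0 mulrC.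
Qed.

(** The mean value theorem is used twice: along [u] for the increment [h (y + t *: v) - h y], which
    gives [a], then along [v] for the derivative of [h] along [u], which gives [b]. *)
Lemma second_difference (R : realType) (V : normedModType R) (U : set V)
    (h : V -> R^o) (x u v : V) (t : R) : 0 < t -> Ck_on 2 U h ->
  (forall a b, 0 <= a <= t -> 0 <= b <= t -> U (x + a *: u + b *: v)) ->
  exists a b, [/\ 0 < a < t, 0 < b < t &
    h (x + t *: u + t *: v) - h (x + t *: u) - (h (x + t *: v) - h x) =
    t * (t * 'D_v (fun y => 'D_u h y) (x + a *: u + b *: v))].
Proof.
move=> t0 [dh Ch] H.
have tt : 0 <= t <= t by rewrite lexx ltW.
have t00 : 0 <= (0 : R) <= t by rewrite lexx ltW.
pose g (y : V) : R^o := h (y + t *: v) - h y.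
have Us s : 0 <= s <= t -> U (x + s *: u).
  by move=> st; have := H s 0 st t00; rewrite scale0r addr0.
have shiftd y w : differentiable h (y + w) ->
    is_diff y (fun z => h (z + w)) ('d h (y + w)).
  move=> dy; pose T := fun z : V => z + w.
  have dT : is_diff y T id by apply: is_diff_eq; rewrite addr0.
  have := is_diff_comp dT (differentiableP (dy : differentiable h (T y))); exact.
have dg s : 0 <= s <= t -> is_diff (x + s *: u) g
    (fun w => 'd h (x + s *: u + t *: v) w - 'd h (x + s *: u) w).
  move=> st; have d1 := shiftd _ _ (dh _ (H s t st tt)).
  have d2 := differentiableP (dh _ (Us _ st)).
  exact: (is_diffB d1 d2).
have [|a at0 E] := @MVT_dir R V g x u t t0; first by move=> s /dg[].
have at1 : 0 <= a <= t by case/andP: at0 => ? ?; rewrite !ltW.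
have [|b bt E2] := @MVT_dir R V (fun y => 'D_u h y) (x + a *: u) v t t0.
  by move=> s st; case: (Ch u) => d _; apply/d/H.
exists a, b; split=> //; rewrite -E2.
rewrite [LHS](_ : _ = g (x + t *: u) - g x) // E.
have [D E3] := dg _ at1; rewrite deriveE // E3.
by rewrite !deriveE //; [exact/dh/Us|exact/dh/H].
Qed.

Lemma dist_half_le (R : realType) (p q z e : R) :
  `|p - z| < e / 2 -> `|q - z| < e / 2 -> `|p - q| <= e.
Proof.
move=> pz qz; rewrite -(subrKA z); apply: (le_trans (ler_normD _ _)).
by rewrite [leRHS]splitr [X in _ + X]distrC lerD // ltW.
Qed.

(** The second difference of [h] over the parallelogram on [t *: u] and [t *: v] is symmetric in [u]
    and [v]. It equals [t * t] times either mixed derivative at some nearby point, and both mixed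
    derivatives are continuous at [x]. *)
Lemma derive_comm_real (R : realType) (V : normedModType R) (U : set V)
    (h : V -> R^o) (x u v : V) : open U -> U x -> Ck_on 2 U h ->
  'D_v (fun y => 'D_u h y) x = 'D_u (fun y => 'D_v h y) x.
Proof.
move=> Uo Ux Ch; apply/eqP; rewrite -subr_eq0 -normr_le0.
apply/ler_addgt0Pl => e e0; rewrite addr0.
have c1 : {for x, continuous (fun y => 'D_v (fun y => 'D_u h y) y)}.
  by case: Ch => _ /(_ u)[_ /(_ v)]; apply.
have c2 : {for x, continuous (fun y => 'D_u (fun y => 'D_v h y) y)}.
  by case: Ch => _ /(_ v)[_ /(_ u)]; apply.
have e2 : 0 < e / 2 by rewrite divr_gt0.
have /cvgrPdist_lt/(_ _ e2) n1 := c1; have /cvgrPdist_lt/(_ _ e2) n2 := c2.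
have nU : nbhs x U by apply: open_nbhs_nbhs.
have [d /= d0 Hd] := (nbhs_ballP _ _).1 (filterI nU (filterI n1 n2)).
(* With [t = d / M / 2], a vector [a *: u + b *: v] with [a] and [b] between [0] and [t] has norm at
   most [t * M = d / 2]. The summand [1] keeps [M] positive when [u = v = 0]. *)
pose M := `|u| + `|v| + 1.
have M0 : 0 < M by rewrite ltr_wpDl // addr_ge0.
pose t := d / M / 2.
have t0 : 0 < t by rewrite !divr_gt0.
have B a b : 0 <= a <= t -> 0 <= b <= t -> ball x d (x + a *: u + b *: v).
  move=> /andP[a0 at1] /andP[b0 bt1].
  rewrite -ball_normE /= -addrA opprD addrA subrr sub0r normrN.
  apply: (le_lt_trans (ler_normD _ _)); rewrite !normrZ !ger0_norm //.
  apply: (@le_lt_trans _ _ (t * M)).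
    by rewrite !mulrDr mulr1 -[X in X <= _]addr0 lerD ?lerD ?ler_wpM2r // ltW.
  rewrite /t mulrAC divfK ?gt_eqF // ltr_pdivrMr // mulr_natr mulr2n.
  by rewrite ltrDl.
have [|a [b [a0 b0 E1]]] := @second_difference R V U h x u v t t0 Ch.
  by move=> a b a0 b0; case: (Hd _ (B a b a0 b0)).
have [|b' [a' [b'0 a'0 E2]]] := @second_difference R V U h x v u t t0 Ch.
  by move=> b' a' b0' a0'; rewrite addrAC; case: (Hd _ (B a' b' a0' b0')).
have := E1; rewrite -[x + t *: u + t *: v]addrAC => E1'.
have E : t * (t * 'D_v (fun y => 'D_u h y) (x + a *: u + b *: v)) =
         t * (t * 'D_u (fun y => 'D_v h y) (x + b' *: v + a' *: u)).
  have swap (p q w z : R) : p - q - (w - z) = p - w - (q - z).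
    by rewrite !opprB addrACA [RHS]addrACA [- q - w]addrC.
  exact: etrans (esym E1') (etrans (swap _ _ _ _) E2).
have tn : t != 0 by rewrite gt_eqF.
move/(mulfI tn)/(mulfI tn): E => E.
have w s : 0 < s < t -> 0 <= s <= t by case/andP => ? ?; rewrite !ltW.
have [_ [/= H1 _]] := Hd _ (B a b (w _ a0) (w _ b0)).
have [_ [/= _ H2]] := Hd _ (B a' b' (w _ a'0) (w _ b'0)).
rewrite E [x + b' *: v + _]addrAC in H1.
exact: dist_half_le H1 H2.
Qed.

Lemma derive_coord (R : realType) (V : normedModType R) n (f : V -> 'rV[R]_n)
    (x v : V) (i : 'I_n) : differentiable f x ->
  'D_v (fun y => f y 0 i : R^o) x = 'D_v f x 0 i.
Proof.
move=> df; have := derive_mx (diff_derivable df : derivable f x v).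
by move=> ->; rewrite mxE.
Qed.

Lemma derive_comm (R : realType) (V : normedModType R) n (U : set V)
    (h : V -> 'rV[R]_n) (x u v : V) : open U -> U x -> Ck_on 2 U h ->
  'D_v (fun y => 'D_u h y) x = 'D_u (fun y => 'D_v h y) x.
Proof.
move=> Uo Ux Ch; apply/rowP => i.
have [dh C1] := Ch.
have E w w' : 'D_w (fun y => 'D_w' h y) x 0 i =
    'D_w (fun y => 'D_w' (fun y => h y 0 i : R^o) y) x.
  rewrite -derive_coord; last by have [d _] := C1 w'; exact: d.
  apply: near_eq_derive; near=> y; rewrite derive_coord //; apply: dh.
  by near: y; apply: open_nbhs_nbhs.
apply: (etrans (E v u)); apply: etrans (esym (E u v)).
exact: (derive_comm_real u v Uo Ux (Ck_on_coord i Uo Ch)).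
Unshelve. all: by end_near. Qed.

(** * Lie brackets in coordinates *)

Definition vbracket (R : realType) n (X Y : 'rV[R]_n -> 'rV[R]_n)
    (y : 'rV[R]_n) : 'rV[R]_n := 'd Y y (X y) - 'd X y (Y y).

Lemma diff_compE (R : realType) (V W W' : normedModType R) (f : V -> W)
    (g : W -> W') (x v : V) :
  differentiable f x -> differentiable g (f x) ->
  'd (g \o f) x v = 'd g (f x) ('d f x v).
Proof. by move=> df dg; rewrite (diff_comp df dg). Qed.

(** This is the derivative along [w] of the relation [Z' (phi y) = 'd phi y (Z y)]. Since [phi] is
    differentiated once more, its second derivative in the directions [w] and [Z y] appears; that
    term will cancel in the bracket. *)
Lemma diff_related (R : realType) m n (O : set 'rV[R]_m)
    (phi : 'rV[R]_m -> 'rV[R]_n) (Z : 'rV[R]_m -> 'rV[R]_m)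
    (Z' : 'rV[R]_n -> 'rV[R]_n) (y w : 'rV[R]_m) :
  open O -> O y -> Ck_on 2 O phi ->
  differentiable Z y -> differentiable Z' (phi y) ->
  (\near y, Z' (phi y) = 'd phi y (Z y)) ->
  'd Z' (phi y) ('d phi y w) = 'd phi y ('d Z y w) +
    'D_w (fun z => 'D_(Z y) phi z) y.
Proof.
move=> Oo Oy [dphi Cphi] dZ dZ' EZ.
have nO : \forall z \near y, O z by apply: open_nbhs_nbhs.
have D2 i : differentiable ('D_('e_i) phi) y by case: (Cphi 'e_i) => d _; exact: d.
(* Splitting ['d phi z (Z z)] along the coordinates of [Z] lets the product rule separate the
   derivative of the field from that of [phi]. *)
pose G i z := Z z 0 i *: 'D_('e_i) phi z.
have dG i : is_diff y (G i) (fun w => Z y 0 i *: 'D_w ('D_('e_i) phi) y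
     + 'd Z y w 0 i *: 'D_('e_i) phi y).
  have D : differentiable (fun z => Z z 0 i : R^o) y.
    by apply: (@differentiable_comp _ _ _ _ Z (fun N : 'rV[R]_m => N 0 i : R^o)) => //;
      exact: differentiable_coord.
  have [D3 E3] := is_diff_scale D (D2 i).
  apply: DiffDef; [exact: D3|rewrite [LHS]E3; apply/funext => v].
  by rewrite (deriveE _ (D2 i)) -(deriveE _ D) derive_coord // (deriveE _ dZ).
have E1 : \forall z \near y, (Z' \o phi) z = (\sum_i G i) z.
  near=> z; rewrite /= (near EZ z) // diff_rV_sum fct_sumE; apply: eq_bigr => i _.
  by rewrite /G deriveE //; apply: dphi; near: z.
have dC := differentiable_comp (dphi _ Oy) dZ'.
have L : 'D_w (Z' \o phi) y = 'd Z' (phi y) ('d phi y w).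
  exact: etrans (deriveE _ dC) (diff_compE w (dphi _ Oy) dZ').
rewrite -L (near_eq_derive _ E1) derive_sum; last first.
  by move=> i; have [D _] := dG i; exact: diff_derivable.
rewrite (eq_bigr (fun i => Z y 0 i *: 'D_w ('D_('e_i) phi) y
     + 'd Z y w 0 i *: 'D_('e_i) phi y)); last first.
  by move=> i _; have [D E] := dG i; rewrite (deriveE _ D) E.
rewrite big_split /= addrC; congr (_ + _).
  rewrite [RHS]diff_rV_sum; apply: eq_bigr => i _.
  by rewrite (deriveE _ (dphi _ Oy)).
(* In the remaining terms the coefficients are frozen at [y], so they add up to the derivative of
   [phi] along the constant vector [Z y]. *)
have E2 : \forall z \near y,
    'D_(Z y) phi z = (\sum_i (fun z => Z y 0 i *: 'D_('e_i) phi z)) z.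
  near=> z; have dz : differentiable phi z by apply: dphi; near: z.
  rewrite (deriveE _ dz) diff_rV_sum fct_sumE; apply: eq_bigr => i _.
  by rewrite (deriveE _ dz).
have Dd i : derivable ('D_('e_i) phi) y w by exact: diff_derivable.
rewrite (near_eq_derive _ E2) derive_sum; last by move=> i; exact: derivableZ.
by apply: eq_bigr => i _; rewrite deriveZ.
Unshelve. all: by end_near. Qed.

(** In the difference of the two instances of [diff_related], along [X y] and along [Y y], the
    second derivatives of [phi] cancel by symmetry. *)
Lemma vbracket_related (R : realType) m n (O : set 'rV[R]_m)
    (phi : 'rV[R]_m -> 'rV[R]_n) (X Y : 'rV[R]_m -> 'rV[R]_m)
    (X' Y' : 'rV[R]_n -> 'rV[R]_n) (y : 'rV[R]_m) :
  open O -> O y -> Ck_on 2 O phi ->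
  differentiable X y -> differentiable Y y ->
  differentiable X' (phi y) -> differentiable Y' (phi y) ->
  (\near y, X' (phi y) = 'd phi y (X y)) ->
  (\near y, Y' (phi y) = 'd phi y (Y y)) ->
  vbracket X' Y' (phi y) = 'd phi y (vbracket X Y y).
Proof.
move=> Oo Oy C dX dY dX' dY' EX EY.
rewrite /vbracket (nbhs_singleton EX) (nbhs_singleton EY).
have E1 := diff_related (X y) Oo Oy C dY dY' EY.
have E2 := diff_related (Y y) Oo Oy C dX dX' EX.
apply: (etrans (f_equal2 (fun a b => a - b) E1 E2)).
rewrite (derive_comm _ _ Oo Oy C) opprD addrACA subrr addr0.
by rewrite [RHS]linearB.
Qed.

Lemma Ck_on_vbracket (R : realType) n k (U : set 'rV[R]_n)
    (X Y : 'rV[R]_n -> 'rV[R]_n) : open U ->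
  Ck_on k.+1 U X -> Ck_on k.+1 U Y -> Ck_on k U (vbracket X Y).
Proof.
move=> Uo CX CY.
have I j : Ck_on j U (id : 'rV[R]_n -> 'rV[R]_n).
  elim: j => [|j IH] /=; first by move=> x _ ; exact: cvg_id.
  split=> // v; have -> : (fun x => 'D_v id x) = cst v.
    by apply/funext => x; rewrite derive_id.
  exact: Ck_on_cst.
have C1 := Ck_on_diff Uo Uo (fun x Ux => Ux) (I k) (Ck_on_le CX) CY.
have C2 := Ck_on_diff Uo Uo (fun x Ux => Ux) (I k) (Ck_on_le CY) CX.
have C3 := Ck_onD Uo C1 (Ck_on_scale Uo (Ck_on_cst k U (-1 : R^o)) C2).
by apply: Ck_on_eq C3 => // x _; rewrite /vbracket scaleN1r.
Qed.

(** * Fields and brackets in charts *)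

Lemma bwd_in_chart (R : realType) n (M : topologicalType) (c : chart R n M)
    (y : 'rV[R]_n) : chart_axiom c -> (fwd c @` dom c) y ->
  dom c (bwd c y) /\ fwd c (bwd c y) = y.
Proof. by case=> _ _ K _ _ [x cx <-]; rewrite K. Qed.

Lemma open_chart_image (R : realType) n (M : topologicalType) (c : chart R n M)
    (U : set M) : chart_axiom c -> open U -> open (fwd c @` (dom c `&` U)).
Proof.
move=> cA Uo; have [_ Io K _ bc] := cA.
rewrite openE => y [x [cx Ux] <-].
have Ix : (fwd c @` dom c) (fwd c x) by exists x.
have nU : nbhs (bwd c (fwd c x)) U by rewrite K //; apply: open_nbhs_nbhs.
have n1 : nbhs (fwd c x) (bwd c @^-1` U) := bc _ Ix _ nU.
have n2 : nbhs (fwd c x) (fwd c @` dom c) by apply: open_nbhs_nbhs.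
apply: filterS (filterI n1 n2) => z [/= Uz Iz].
by have [dz e] := bwd_in_chart cA Iz; exists (bwd c z).
Qed.

Lemma open_preimage_on (T T' : topologicalType) (U : set T) (f : T -> T')
    (O : set T') : open U -> (forall x, U x -> {for x, continuous f}) ->
  open O -> open (U `&` f @^-1` O).
Proof.
move=> Uo fc Oo; rewrite openE => x [Ux /= Ofx].
apply: filterI; first exact: open_nbhs_nbhs.
by apply: (fc _ Ux); apply: open_nbhs_nbhs.
Qed.

(** For [f = id] this is the change of coordinates from [c] to [d]. Both [field_in] and
    [tangent_map] are instances, so one chain rule serves naturality as well as independence of the
    chart. *)
Definition chart_diff (R : realType) m n (M : topologicalType)
    (N : topologicalType) (f : M -> N) (c : chart R m M) (d : chart R n N)
    (x : M) : 'rV[R]_m -> 'rV[R]_n :=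
  'd (fwd d \o f \o bwd c) (fwd c x).

Lemma chart_diff_id (R : realType) n (M : manifold R n) (c : chart R n M)
    (x : M) (v : 'rV[R]_n) : atlas c -> dom c x -> chart_diff id c c x v = v.
Proof.
move=> cA cx; have H := atlas_chart cA.
have n1 : \forall y \near fwd c x, id y = (fwd c \o id \o bwd c) y.
  have Io : open (fwd c @` dom c) by case: H.
  have : nbhs (fwd c x) (fwd c @` dom c).
    by apply: open_nbhs_nbhs; split=> //; exists x.
  by apply: filterS => y /(bwd_in_chart H)[_ /= ->].
have [_ E] := near_differentiable n1 (ex_diff : differentiable id (fwd c x)).
rewrite /chart_diff E.
by rewrite diff_val.
Qed.

Lemma chart_diff_comp (R : realType) m n k (M : manifold R m)
    (N : manifold R n) (P : manifold R k) (f : M -> N) (g : N -> P)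
    (U : set M) (V : set N) (c : chart R m M) (d : chart R n N)
    (e : chart R k P) (x : M) (v : 'rV[R]_m) :
  open U -> open V -> smooth_map U f -> smooth_map V g ->
  atlas c -> atlas d -> atlas e ->
  U x -> V (f x) -> dom c x -> dom d (f x) -> dom e (g (f x)) ->
  chart_diff (g \o f) c e x v = chart_diff g d e (f x) (chart_diff f c d x v).
Proof.
move=> Uo Vo [fc fs] [gc gs] cA dA eA Ux Vfx cx dfx egfx.
have cH := atlas_chart cA; have dH := atlas_chart dA.
have [co _ cK _ _] := cH; have [do_ _ dK _ _] := dH.
pose F := fwd d \o f \o bwd c; pose G := fwd e \o g \o bwd d.
have EF : F (fwd c x) = fwd d (f x) by rewrite /F /= cK.
have dF : differentiable F (fwd c x).
  have [D _] := fs c d cA dA 1%N; apply: D.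
  by exists x.
have dG : differentiable G (F (fwd c x)).
  rewrite EF; have [D _] := gs d e dA eA 1%N; apply: D.
  by exists (f x).
have n1 : \forall y \near fwd c x, (G \o F) y = (fwd e \o (g \o f) \o bwd c) y.
  have O : open (fwd c @` (dom c `&` (U `&` f @^-1` dom d))).
    by apply: open_chart_image => //; apply: open_preimage_on.
  have : nbhs (fwd c x) (fwd c @` (dom c `&` (U `&` f @^-1` dom d))).
    by apply: open_nbhs_nbhs; split=> //; exists x.
  by apply: filterS => y [z [cz [Uz dz]] <-]; rewrite /G /F /= cK // dK.
have [_ E] := near_differentiable n1 (differentiable_comp dF dG).
rewrite /chart_diff E.
by apply: etrans (diff_compE v dF dG) _; rewrite EF.
Qed.

Lemma smooth_map_id (R : realType) n (M : manifold R n) : smooth_map setT (@id M).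
Proof.
split=> [x _|c d cA dA k]; first exact: cvg_id.
apply: Ck_on_sub (atlas_compatible cA dA k).
by move=> _ [x [[cx _] dx] <-]; exists x.
Qed.

Lemma field_inE (R : realType) n (M : manifold R n) (X : M -> 'rV[R]_n)
    (c : chart R n M) (x : M) : atlas c -> dom c x ->
  field_in c X (fwd c x) = chart_diff id (chart_at x) c x (X x).
Proof.
by move=> cA cx; have [_ _ K _ _] := atlas_chart cA; rewrite /field_in K.
Qed.

Lemma tangent_mapE (R : realType) m n (M : manifold R m) (N : manifold R n)
    (f : M -> N) (x : M) (v : 'rV[R]_m) :
  tangent_map f x v = chart_diff f (chart_at x) (chart_at (f x)) x v.
Proof. by rewrite lfunE. Qed.

(** Both sides apply to [X x] the derivative of [f] from [chart_at x] to [d], factored through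
    [chart_at (f x)] on the left and through [c] on the right. *)
Lemma field_in_related (R : realType) m n (M : manifold R m) (N : manifold R n)
    (f : M -> N) (U : set M) (X : M -> 'rV[R]_m) (X' : N -> 'rV[R]_n)
    (c : chart R m M) (d : chart R n N) (x : M) :
  open U -> smooth_map U f -> atlas c -> atlas d ->
  U x -> dom c x -> dom d (f x) -> X' (f x) = tangent_map f x (X x) ->
  field_in d X' (fwd d (f x)) = chart_diff f c d x (field_in c X (fwd c x)).
Proof.
move=> Uo fs cA dA Ux cx dfx E.
rewrite !field_inE // E tangent_mapE.
have H1 := chart_diff_comp (X x) Uo openT fs (@smooth_map_id _ _ N)
  (chart_at_atlas x) (chart_at_atlas (f x)) dA Ux I (dom_chart_at x)
  (dom_chart_at (f x)) dfx.
have H2 := chart_diff_comp (X x) openT Uo (@smooth_map_id _ _ M) fs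
  (chart_at_atlas x) cA dA I Ux (dom_chart_at x) cx dfx.
exact: etrans (esym H1) H2.
Qed.

Lemma tangent_map_id (R : realType) n (M : manifold R n) (x : M)
    (v : 'rV[R]_n) : tangent_map id x v = v.
Proof.
rewrite tangent_mapE; apply: chart_diff_id; first exact: chart_at_atlas.
exact: dom_chart_at.
Qed.

Lemma field_in_differentiable (R : realType) n (M : manifold R n) (U : set M)
    (X : M -> 'rV[R]_n) (c : chart R n M) (x : M) :
  smooth_field U X -> atlas c -> U x -> dom c x ->
  differentiable (field_in c X) (fwd c x).
Proof.
by move=> Xs cA Ux cx; have [D _] := Xs c cA 1%N; apply: D; exists x.
Qed.

(** The charts are arbitrary for the sake of two uses: with [chart_at] on both sides this is
    naturality of the bracket under [f], and with [f = id] it compares the coordinate formulas of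
    the bracket in two charts. *)
Lemma vbracket_chart_related (R : realType) m n (M : manifold R m)
    (N : manifold R n) (f : M -> N) (U : set M) (U' : set N)
    (X Y : M -> 'rV[R]_m) (X' Y' : N -> 'rV[R]_n)
    (c : chart R m M) (d : chart R n N) (x : M) :
  open U -> smooth_map U f -> atlas c -> atlas d ->
  U x -> U' (f x) -> dom c x -> dom d (f x) ->
  smooth_field U X -> smooth_field U Y ->
  smooth_field U' X' -> smooth_field U' Y' ->
  (forall x, U x -> X' (f x) = tangent_map f x (X x)) ->
  (forall x, U x -> Y' (f x) = tangent_map f x (Y x)) ->
  vbracket (field_in d X') (field_in d Y') (fwd d (f x)) =
  chart_diff f c d x (vbracket (field_in c X) (field_in c Y) (fwd c x)).
Proof.
move=> Uo fs cA dA Ux U'fx cx dfx Xs Ys X's Y's EX EY.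
have cH := atlas_chart cA; have [co _ cK _ _] := cH.
have [do_ _ _ _ _] := atlas_chart dA; have [fc fk] := fs.
pose O := fwd c @` (dom c `&` (U `&` f @^-1` dom d)).
have Oo : open O by apply: open_chart_image => //; apply: open_preimage_on.
pose F := fwd d \o f \o bwd c.
have EF : F (fwd c x) = fwd d (f x) by rewrite /F /= cK.
have Ox : O (fwd c x) by exists x.
have CF : Ck_on 2 O F.
  apply: Ck_on_sub (fk c d cA dA 2%N).
  by move=> _ [z [cz [Uz dz]] <-]; exists z.
have rel (Z : M -> 'rV[R]_m) (Z' : N -> 'rV[R]_n) :
    (forall x, U x -> Z' (f x) = tangent_map f x (Z x)) ->
    \forall y \near fwd c x, field_in d Z' (F y) = 'd F y (field_in c Z y).
  move=> EZ; have : nbhs (fwd c x) O by apply: open_nbhs_nbhs.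
  apply: filterS => _ [z [cz [Uz dz]] <-]; rewrite {1}/F /= cK //.
  exact: (field_in_related Uo fs cA dA Uz cz dz (EZ z Uz)).
rewrite -EF; apply: (vbracket_related Oo Ox CF).
- exact: field_in_differentiable Xs cA Ux cx.
- exact: field_in_differentiable Ys cA Ux cx.
- by rewrite EF; exact: field_in_differentiable X's dA U'fx dfx.
- by rewrite EF; exact: field_in_differentiable Y's dA U'fx dfx.
- exact: rel.
- exact: rel.
Qed.

Lemma lie_bracket_related (R : realType) m n (M : manifold R m)
    (N : manifold R n) (f : M -> N) (U : set M) (U' : set N)
    (X Y : M -> 'rV[R]_m) (X' Y' : N -> 'rV[R]_n) (x : M) :
  open U -> smooth_map U f -> U x -> U' (f x) ->
  smooth_field U X -> smooth_field U Y ->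
  smooth_field U' X' -> smooth_field U' Y' ->
  (forall x, U x -> X' (f x) = tangent_map f x (X x)) ->
  (forall x, U x -> Y' (f x) = tangent_map f x (Y x)) ->
  lie_bracket X' Y' (f x) = tangent_map f x (lie_bracket X Y x).
Proof.
move=> Uo fs Ux U'fx Xs Ys X's Y's EX EY; rewrite tangent_mapE.
exact: (vbracket_chart_related Uo fs (chart_at_atlas x) (chart_at_atlas (f x))
  Ux U'fx (dom_chart_at x) (dom_chart_at (f x)) Xs Ys X's Y's EX EY).
Qed.

(** [lie_bracket] is computed at each point in the chart of that point, so its smoothness becomes
    visible only after it is expressed in one fixed chart. *)
Lemma field_in_lie_bracket (R : realType) n (M : manifold R n) (U : set M)
    (X Y : M -> 'rV[R]_n) (c : chart R n M) (x : M) :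
  open U -> atlas c -> U x -> dom c x -> smooth_field U X -> smooth_field U Y ->
  field_in c (lie_bracket X Y) (fwd c x) =
  vbracket (field_in c X) (field_in c Y) (fwd c x).
Proof.
move=> Uo cA Ux cx Xs Ys; rewrite field_inE //.
have ids : smooth_map U (@id M).
  have [h1 h2] := @smooth_map_id _ _ M; split=> [y _|a b aA bA k]; first exact: h1.
  by apply: Ck_on_sub (h2 a b aA bA k) => _ [z [[az _] bz] <-]; exists z.
have T Z (y : M) : U y -> Z (id y) = tangent_map id y (Z y) by rewrite tangent_map_id.
by rewrite (vbracket_chart_related Uo ids (chart_at_atlas x) cA Ux Ux
  (dom_chart_at x) cx Xs Ys Xs Ys (T X) (T Y)).
Qed.

Lemma smooth_lie_bracket (R : realType) n (M : manifold R n) (U : set M)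
    (X Y : M -> 'rV[R]_n) : open U -> smooth_field U X -> smooth_field U Y ->
  smooth_field U (lie_bracket X Y).
Proof.
move=> Uo Xs Ys c cA k.
have Oo : open (fwd c @` (dom c `&` U)).
  exact: open_chart_image (atlas_chart cA) Uo.
apply: Ck_on_eq (Ck_on_vbracket Oo (Xs c cA k.+1) (Ys c cA k.+1)) => //.
move=> _ [x [cx Ux] <-].
by rewrite (field_in_lie_bracket Uo cA Ux cx Xs Ys).
Qed.

Definition pushforward (R : realType) m n (M : manifold R m) (N : manifold R n)
    (f : M -> N) (g : N -> M) (X : M -> 'rV[R]_m) (y : N) : 'rV[R]_n :=
  tangent_map f (g y) (X (g y)).

(** With [c] a chart at [x], and [F], [G] the coordinate expressions of [f] and [g], the field near
    [f x] reads as ['d F (G z)] applied to the coordinates of [X] at [G z]. The chart [c] serves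
    only near [x], whence the localisation. *)
Lemma smooth_pushforward (R : realType) m n (M : manifold R m)
    (N : manifold R n) (f : M -> N) (g : N -> M) (U : set M)
    (X : M -> 'rV[R]_m) :
  open U -> open (f @` U) -> smooth_map U f -> smooth_map (f @` U) g ->
  (forall x, U x -> g (f x) = x) -> smooth_field U X ->
  smooth_field (f @` U) (pushforward f g X).
Proof.
move=> Uo fUo fs gs gK Xs d dA k; apply: Ck_on_local => _ [y [dy [x Ux xy]] <-].
pose c := chart_at x; have cA : atlas c := chart_at_atlas x.
have [co _ cK _ _] := atlas_chart cA; have [do_ _ dK _ _] := atlas_chart dA.
have [fc fk] := fs; have [gc gk] := gs.
pose O := fwd d @` (dom d `&` (f @` U `&` g @^-1` dom c)).
have Oo : open O.
  by apply: open_chart_image (atlas_chart dA) _; apply: open_preimage_on.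
exists O.
  exists y => //; split=> //; split; first by exists x.
  by rewrite -xy /= gK //; exact: dom_chart_at.
pose G := fwd c \o g \o bwd d; pose F := fwd d \o f \o bwd c.
pose O1 := fwd c @` (dom c `&` U).
have O1o : open O1 by apply: open_chart_image (atlas_chart cA) _.
pose O2 := fwd c @` (dom c `&` (U `&` f @^-1` dom d)).
have O2o : open O2.
  by apply: open_chart_image (atlas_chart cA) _; apply: open_preimage_on.
have CG : Ck_on k O G.
  apply: Ck_on_sub (gk d c dA cA k) => _ [z [dz [fz cz]] <-].
  by exists z.
have CX : Ck_on k O1 (field_in c X) by exact: Xs.
have CF : Ck_on k.+1 O2 F.
  by apply: Ck_on_sub (fk c d cA dA k.+1) => _ [z [cz [Uz dz]] <-]; exists z.
have GO1 z : O z -> O1 (G z).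
  move=> [w [dw [[u Uu uw] cw]] <-]; rewrite /G /= dK //.
  by exists (g w) => //; split=> //; rewrite -uw gK.
have GO2 z : O z -> O2 (G z).
  move=> [w [dw [[u Uu uw] cw]] <-]; rewrite /G /= dK //.
  by exists (g w) => //; split=> //; rewrite -uw gK //; split=> //=; rewrite uw.
have C1 := Ck_on_comp Oo O1o GO1 CG CX.
have C2 := Ck_on_diff Oo O2o GO2 CG C1 CF.
apply: Ck_on_eq C2 => // _ [w [dw [[u Uu uw] cw]] <-].
rewrite /G /= dK //; move: dw cw; rewrite -uw => dw cw.
move: (cw); rewrite /= gK // => cu.
apply: esym; apply: (field_in_related Uo fs cA dA Uu cu dw).
by rewrite /pushforward gK.
Qed.

(** * Brackets of sections of the flag *)

Lemma smooth_field_sub (R : realType) n (M : manifold R n) (U U' : set M)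
    (X : M -> 'rV[R]_n) : U' `<=` U -> smooth_field U X -> smooth_field U' X.
Proof.
move=> UU' Xs c cA k; apply: Ck_on_sub (Xs c cA k).
by move=> _ [x [cx /UU' Ux] <-]; exists x.
Qed.

Lemma tangent_field_sub (R : realType) n (M : manifold R n)
    (E : M -> {vspace 'rV[R]_n}) (U U' : set M) (X : M -> 'rV[R]_n) :
  U' `<=` U -> tangent_field E U X -> tangent_field E U' X.
Proof.
move=> UU' [Xs XE]; split; first exact: smooth_field_sub Xs.
by move=> x /UU'/XE.
Qed.

Lemma field_in_linear (R : realType) n (M : manifold R n) (X Y : M -> 'rV[R]_n)
    (c : chart R n M) (a : R) :
  field_in c (fun x => a *: X x + Y x) =
  (fun y => a *: field_in c X y + field_in c Y y).
Proof. by apply/funext => y; rewrite /field_in linearP. Qed.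

Lemma tangent_field_linear (R : realType) n (M : manifold R n)
    (E : M -> {vspace 'rV[R]_n}) (U : set M) (X Y : M -> 'rV[R]_n) (a : R) :
  open U -> tangent_field E U X -> tangent_field E U Y ->
  tangent_field E U (fun x => a *: X x + Y x).
Proof.
move=> Uo [Xs XE] [Ys YE]; split=> [c cA k|x Ux].
  have Oo : open (fwd c @` (dom c `&` U)).
    exact: open_chart_image (atlas_chart cA) Uo.
  rewrite field_in_linear; apply: (Ck_onD Oo _ (Ys c cA k)).
  exact: (Ck_on_scale Oo (Ck_on_cst k _ (a : R^o)) (Xs c cA k)).
by rewrite memvD ?memvZ ?XE ?YE.
Qed.

Lemma tangent_field0 (R : realType) n (M : manifold R n)
    (E : M -> {vspace 'rV[R]_n}) (U : set M) :
  open U -> tangent_field E U (fun=> 0).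
Proof.
move=> Uo; split=> [c cA k|x _]; last exact: mem0v.
have -> : field_in c (fun=> 0 : 'rV[R]_n) = cst 0.
  by apply/funext => y; rewrite /field_in linear0.
exact: Ck_on_cst.
Qed.

Lemma iterated_bracket_sub (R : realType) n (M : manifold R n)
    (E : M -> {vspace 'rV[R]_n}) (U U' : set M) k (X : M -> 'rV[R]_n) :
  U' `<=` U -> iterated_bracket E U k X -> iterated_bracket E U' k X.
Proof.
move=> UU'; elim=> {k X} [X XE|i j X Y _ IX _ IY].
  by apply: iterated_bracket0; apply: tangent_field_sub XE.
exact: iterated_bracketS.
Qed.

Lemma iterated_bracket_smooth (R : realType) n (M : manifold R n)
    (E : M -> {vspace 'rV[R]_n}) (U : set M) k (X : M -> 'rV[R]_n) :
  open U -> iterated_bracket E U k X -> smooth_field U X.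
Proof.
by move=> Uo; elim=> {k X} [X []//|i j X Y _ IX _ IY]; exact: smooth_lie_bracket.
Qed.

Lemma mem_flag (R : realType) n (M : manifold R n)
    (E : M -> {vspace 'rV[R]_n}) (U : set M) k i (X : M -> 'rV[R]_n) (x : M) :
  open U -> U x -> (k <= i)%N -> iterated_bracket E U k X ->
  X x \in flag E i x.
Proof.
move=> Uo Ux ki HX; apply/set_spanP; exists [:: X x]; last exact/memv_span/mem_head.
by move=> u; rewrite inE => /eqP ->; exists U, k, X.
Qed.

Lemma set_span_ind (K : fieldType) (V : vectType K) (S : set V) (P : V -> Prop) :
  P 0 -> (forall a u v, P u -> P v -> P (a *: u + v)) ->
  (forall v, S v -> P v) -> forall v, v \in set_span S -> P v.
Proof.
move=> P0 PD PS v /set_spanP[s sS]; elim: s v sS => [|w s IH] v sS.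
  by rewrite span_nil memv0 => /eqP ->.
rewrite span_cons => /memv_addP[u /vlineP[a ->] [u' u's ->]].
apply: PD; first by apply/PS/sS/mem_head.
by apply: IH => // z zs; apply: sS; rewrite inE zs orbT.
Qed.

Lemma flag_subv (R : realType) n (M : manifold R n)
    (E : M -> {vspace 'rV[R]_n}) i j (x : M) :
  (i <= j)%N -> (flag E i x <= flag E j x)%VS.
Proof.
move=> ij; apply/subvP; apply: (@set_span_ind _ _ _ (fun v => v \in flag E j x)).
- exact: mem0v.
- by move=> a u v Hu Hv; rewrite memvD ?memvZ.
- move=> v [U [k [X [Uo Ux ki HX ->]]]].
  exact: mem_flag Uo Ux (leq_trans ki ij) HX.
Qed.

Lemma iterated_bracket_tangent (R : realType) n (M : manifold R n)
    (E : M -> {vspace 'rV[R]_n}) (U : set M) k i (X : M -> 'rV[R]_n) :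
  open U -> (k <= i)%N -> iterated_bracket E U k X ->
  tangent_field (flag E i) U X.
Proof.
move=> Uo ki HX; split; first exact: iterated_bracket_smooth HX.
by move=> x Ux; exact: mem_flag HX.
Qed.

(** The induction carries relatedness instead of an equation with [pushforward]: the bracket of two
    pushforwards is compared with the pushforward of the bracket only on the image of [U], whereas
    [iterated_bracket] speaks of the function itself. *)
Lemma pushforward_iterated_bracket (R : realType) m n (M : manifold R m)
    (N : manifold R n) (E : M -> {vspace 'rV[R]_m}) (E' : N -> {vspace 'rV[R]_n})
    (f : M -> N) (g : N -> M) (U : set M) k (X : M -> 'rV[R]_m) :
  open U -> open (f @` U) -> smooth_map U f -> smooth_map (f @` U) g ->
  (forall x, U x -> g (f x) = x) ->
  (forall x, U x -> (tangent_map f x @: E x <= E' (f x))%VS) ->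
  iterated_bracket E U k X ->
  exists2 X', iterated_bracket E' (f @` U) k X' &
    forall x, U x -> X' (f x) = tangent_map f x (X x).
Proof.
move=> Uo fUo fs gs gK fE; elim=> {k X} [X [Xs XE]|i j X Y HX IX HY IY].
  have rel x : U x -> pushforward f g X (f x) = tangent_map f x (X x).
    by move=> Ux; rewrite /pushforward gK.
  exists (pushforward f g X) => //; apply: iterated_bracket0; split.
    exact: smooth_pushforward.
  move=> _ [x Ux <-]; rewrite rel //; apply: (subvP (fE x Ux)).
  by apply: memv_img; exact: XE.
have [X' HX' EX] := IX; have [Y' HY' EY] := IY.
exists (lie_bracket X' Y'); first exact: iterated_bracketS.
move=> x Ux; have fUx : (f @` U) (f x) by exists x.
exact: (lie_bracket_related Uo fs Ux fUx (iterated_bracket_smooth Uo HX)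
  (iterated_bracket_smooth Uo HY) (iterated_bracket_smooth fUo HX')
  (iterated_bracket_smooth fUo HY')).
Qed.

(** * Limits of row spaces and derivatives of vanishing sections *)

Lemma cvg_sumr (R : realType) (T I : Type) (F : set_system T) (s : seq I)
    (f : I -> T -> R) (l : I -> R) (FF : Filter F) :
  (forall i, f i t @[t --> F] --> l i) ->
  \sum_(i <- s) f i t @[t --> F] --> \sum_(i <- s) l i.
Proof.
move=> H; elim: s => [|i s IH].
  rewrite big_nil (_ : (fun t => _) = cst 0); first exact: cvg_cst.
  by apply/funext => t; rewrite big_nil.
rewrite big_cons (_ : (fun t => _) = (fun t => f i t + \sum_(i <- s) f i t)).
  exact: cvgD.
by apply/funext => t; rewrite big_cons.
Qed.

Lemma cvg_prodr (R : realType) (T I : Type) (F : set_system T) (s : seq I)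
    (f : I -> T -> R) (l : I -> R) (FF : Filter F) :
  (forall i, f i t @[t --> F] --> l i) ->
  \prod_(i <- s) f i t @[t --> F] --> \prod_(i <- s) l i.
Proof.
move=> H; elim: s => [|i s IH].
  rewrite big_nil (_ : (fun t => _) = cst 1); first exact: cvg_cst.
  by apply/funext => t; rewrite big_nil.
rewrite big_cons (_ : (fun t => _) = (fun t => f i t * \prod_(i <- s) f i t)).
  exact: cvgM.
by apply/funext => t; rewrite big_cons.
Qed.

Lemma cvg_mulmx_entries (R : realType) (T : Type) (F : set_system T) m n k
    (A : T -> 'M[R]_(m, n)) (B : T -> 'M[R]_(n, k))
    (A0 : 'M[R]_(m, n)) (B0 : 'M[R]_(n, k)) (FF : Filter F) :
  (forall i j, A t i j @[t --> F] --> (A0 i j : R)) ->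
  (forall i j, B t i j @[t --> F] --> (B0 i j : R)) ->
  forall i j, (A t *m B t) i j @[t --> F] --> ((A0 *m B0) i j : R).
Proof.
move=> HA HB i j; rewrite mxE; under eq_fun do rewrite mxE.
by apply: cvg_sumr => l; apply: cvgM.
Qed.

Lemma cvg_det_entries (R : realType) (T : Type) (F : set_system T) n
    (A : T -> 'M[R]_n) (A0 : 'M[R]_n) (FF : Filter F) :
  (forall i j, A t i j @[t --> F] --> (A0 i j : R)) ->
  \det (A t) @[t --> F] --> (\det A0 : R).
Proof.
move=> HA; apply: cvg_sumr => s; apply: cvgM; first exact: cvg_cst.
by apply: cvg_prodr => i; exact: HA.
Qed.

Lemma cvg_adj_entries (R : realType) (T : Type) (F : set_system T) n
    (A : T -> 'M[R]_n) (A0 : 'M[R]_n) (FF : Filter F) :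
  (forall i j, A t i j @[t --> F] --> (A0 i j : R)) ->
  forall i j, (\adj (A t)) i j @[t --> F] --> ((\adj A0) i j : R).
Proof.
move=> HA i j; rewrite mxE; under eq_fun do rewrite mxE.
rewrite /cofactor; apply: cvgM; first exact: cvg_cst.
apply: cvg_det_entries => a b.
by rewrite !mxE; under eq_fun do rewrite !mxE; exact: HA.
Qed.

Lemma cvg_entry (R : realType) (T : Type) (F : set_system T) m n
    (A : T -> 'M[R]_(m, n)) (A0 : 'M[R]_(m, n)) i j (FF : Filter F) :
  A t @[t --> F] --> A0 -> A t i j @[t --> F] --> (A0 i j : R).
Proof.
move=> H.
exact: (cvg_comp A (fun N : 'M[R]_(m, n) => N i j : R) H
  (@coord_continuous _ _ _ i j A0)).
Qed.

(* [w *m C *m \adj (F *m C) *m F = \det (F *m C) *: w] holds for every [w] in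
   the row space of [F], and is polynomial in [F] and [w], so it passes to the
   limit, where [F *m C = 1%:M]. *)
Lemma submx_closed (R : realType) (T : Type) (F : set_system T) k n
    (A : T -> 'M[R]_(k, n)) (A0 : 'M[R]_(k, n)) (w : T -> 'rV[R]_n)
    (w0 : 'rV[R]_n) : ProperFilter F -> row_free A0 ->
  (forall i j, A t i j @[t --> F] --> (A0 i j : R)) ->
  (forall i j, w t i j @[t --> F] --> (w0 i j : R)) ->
  (\forall t \near F, (w t <= A t)%MS) -> (w0 <= A0)%MS.
Proof.
move=> FF /row_freeP[C AC] HA Hw wA.
have HC i j : C i j @[t --> F] --> (C i j : R) by exact: cvg_cst.
have H1 := cvg_mulmx_entries FF HA HC.
have H2 := cvg_mulmx_entries FF (cvg_mulmx_entries FF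
  (cvg_mulmx_entries FF Hw HC) (cvg_adj_entries FF H1)) HA.
suff -> : w0 = w0 *m C *m A0 by rewrite submxMl.
apply/matrixP => i j.
have L1 := H2 i j; rewrite AC adj1 mulmx1 in L1.
have L2 := @cvgM _ _ _ FF _ _ _ _ (cvg_det_entries FF H1) (Hw i j).
rewrite AC det1 mul1r in L2.
have E : \forall t \near F, \det (A t *m C) * w t i j =
    (w t *m C *m \adj (A t *m C) *m A t) i j.
  apply: filterS wA => t /submxP[D ->].
  rewrite -[D *m A t *m C]mulmxA -[D *m _ *m \adj _]mulmxA mul_mx_adj.
  by rewrite mul_mx_scalar -scalemxAl [RHS]mxE.
have L3 := @cvg_trans _ _ _ _ (@near_eq_cvg _ _ F FF _ _ E) L2.
exact: (@cvg_unique _ (@norm_hausdorff _ R^o) _ _ _ _ L3 L1).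
Qed.

(** As [X p = 0], the derivative along [v] is the limit of [t^-1] times the value of [X] at
    [t *: v + z0], a vector in the span of the frame at that point. The frame tends to a free family
    at [p], so [submx_closed] keeps the limit in the span. *)
Lemma diff_vanishing_section (R : realType) n (M : manifold R n)
    (E : M -> {vspace 'rV[R]_n}) (U U' : set M) (X : M -> 'rV[R]_n) (p : M)
    (v : 'rV[R]_n) : smooth_subbundle U E -> U p -> open U' -> U' p ->
  tangent_field E U' X -> X p = 0 ->
  'd (field_in (chart_at p) X) (fwd (chart_at p) p) v \in E p.
Proof.
move=> Es Up U'o U'p [Xs XE] Xp.
have [V [k [F [Vo Vp Fs Fb]]]] := Es p Up.
set c := chart_at p; set z0 := fwd c p.
have cA : atlas c := chart_at_atlas p; have cp : dom c p := dom_chart_at p.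
have cH := atlas_chart cA; have [_ _ cK _ _] := cH.
(* The rows are a local frame of [E] read in the single chart [c]. At [z0] the reading changes
   nothing, since [c] is the chart that represents the tangent space at [p]. *)
pose A z := \matrix_(i < k) field_in c (F i) z.
have field_p Z : field_in c Z z0 = Z p by rewrite field_inE // chart_diff_id.
have dX : differentiable (field_in c X) z0.
  exact: field_in_differentiable Xs cA U'p cp.
pose q t := t^-1 *: (field_in c X (t *: v + z0) - field_in c X z0).
have Hq i j : q t i j @[t --> 0^'] --> ('d (field_in c X) z0 v i j : R).
  rewrite -deriveE //.
  have Hc := diff_derivable (v := v) dX.
  have Hq : q t @[t --> 0^'] --> 'D_v (field_in c X) z0 := Hc.
  exact: cvg_entry Hq.
have shift0 : t *: v + z0 @[t --> (0 : R^o)^'] --> z0.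
  rewrite -[X in _ --> X]add0r -[X in X + _](scale0r v).
  apply: cvgD; last exact: cvg_cst.
  apply: cvgZr_tmp; apply: cvg_within.
have HA i j : A (t *: v + z0) i j @[t --> 0^'] --> (A z0 i j : R).
  rewrite mxE; under eq_fun do rewrite mxE.
  have cF : {for z0, continuous (field_in c (F i))}.
    apply: differentiable_continuous.
    exact: field_in_differentiable (Fs i) cA Vp cp.
  have H1 := cvg_comp _ _ shift0 cF.
  exact: cvg_entry H1.
have rowA i : row i (A z0) = F i p by rewrite rowK field_p.
have memA w : (w <= A z0)%MS -> w \in E p.
  move=> /submxP[D ->]; rewrite mulmx_sum_row; apply: memv_suml => i _.
  rewrite rowA memvZ //; have /andP[/eqP <- _] := Fb p Vp.
  exact: memv_span (codom_f (F^~ p) i).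
have freeA : row_free (A z0).
  have /andP[_] := Fb p Vp.
  rewrite -[X in free X]in_tupleE => /freeP fr.
  have sz : size [seq F i p | i : 'I_k] = k by rewrite size_map size_enum_ord.
  apply: inj_row_free => w; rewrite mulmx_sum_row => w0.
  have := fr (fun i => w 0 (cast_ord sz i)).
  have nthF (i : 'I_(size [seq F i p | i : 'I_k])) :
      [seq F i p | i : 'I_k]`_i = F (cast_ord sz i) p.
    rewrite (nth_map (cast_ord sz i)) ?size_enum_ord -?[X in (_ < X)%N]sz //.
    congr (F _ p); exact: (nth_ord_enum (cast_ord sz i) (cast_ord sz i)).
  have -> : \sum_(i < size [seq F i p | i : 'I_k])
      w 0 (cast_ord sz i) *: [seq F i p | i : 'I_k]`_i = 0.
    rewrite -[RHS]w0 [RHS](reindex (cast_ord sz)); last first.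
      by exists (cast_ord (esym sz)) => i _; rewrite ?cast_ordK ?cast_ordKV.
    by apply: eq_bigr => i _; rewrite nthF rowA.
  move=> /(_ erefl) w1; apply/rowP => i; rewrite mxE.
  by rewrite -(w1 (cast_ord (esym sz) i)) cast_ordKV.
apply: memA; apply: (submx_closed _ freeA HA Hq).
have n0 : nbhs z0 (fwd c @` (dom c `&` (V `&` U'))).
  apply: open_nbhs_nbhs; split; last by exists p.
  by apply: open_chart_image => //; exact: openI.
have n1 : \forall t \near (0 : R^o)^', (fwd c @` (dom c `&` (V `&` U'))) (t *: v + z0).
  exact: shift0 n0.
apply: filterS n1 => t [y [cy [Vy U'y]] yt].
rewrite /q; apply: scalemx_sub; rewrite field_p Xp subr0 -yt.
have /andP[/eqP sp _] := Fb y Vy.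
have := XE y U'y; rewrite -sp field_inE // => Xy.
have [a ->] : exists a : 'I_k -> R, X y = \sum_i a i *: F i y.
  move: Xy; rewrite span_def big_image => /memv_sumP[us usP ->].
  have /choice[a aP] : forall i, exists a, us i = a *: F i y.
    by move=> i; have /vlineP[a ->] := usP i isT; exists a.
  by exists a; apply: eq_bigr.
(* The change of chart at [y] is linear, so it carries the expansion of [X y] in the frame to a
   combination of the rows of [A]. *)
rewrite {1}/chart_diff linear_sum; apply: summx_sub => i _.
rewrite linearZ; apply: scalemx_sub.
by have := row_sub i (A (fwd c y)); rewrite rowK field_inE.
Qed.

(** * Brackets at a point modulo the bundles *)

Lemma diff_linear_comb (R : realType) (V W : normedModType R) (f g : V -> W)
    (x v : V) (a : R) : differentiable f x -> differentiable g x ->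
  'd (fun y => a *: f y + g y) x v = a *: 'd f x v + 'd g x v.
Proof.
move=> df dg.
rewrite (_ : (fun y => _) = a *: f + g) // (diffD (differentiableZ a df) dg).
by rewrite -[LHS]/('d (a *: f) x v + 'd g x v) (diffZ a df).
Qed.

Lemma vbracket_linearl (R : realType) n (X X' Y : 'rV[R]_n -> 'rV[R]_n)
    (a : R) (z : 'rV[R]_n) : differentiable X z -> differentiable X' z ->
  vbracket (fun y => a *: X y + X' y) Y z = a *: vbracket X Y z + vbracket X' Y z.
Proof.
move=> dX dX'.
have E := diff_linear_comb (Y z) a dX dX'.
have E' : 'd Y z (a *: X z + X' z) = a *: 'd Y z (X z) + 'd Y z (X' z).
  exact: linearP.
apply: (etrans (f_equal2 (fun u v => u - v) E' E)).
have alg (p q r s : 'rV[R]_n) :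
    a *: p + q - (a *: r + s) = a *: (p - r) + (q - s).
  by rewrite scalerBr opprD addrACA.
exact: alg.
Qed.

Definition section_at (R : realType) n (M : manifold R n)
    (E : M -> {vspace 'rV[R]_n}) (p : M) (X : M -> 'rV[R]_n) : Prop :=
  exists U : set M, [/\ open U, U p & tangent_field E U X].

Lemma section_at_linear (R : realType) n (M : manifold R n)
    (E : M -> {vspace 'rV[R]_n}) (p : M) (a : R) (X Y : M -> 'rV[R]_n) :
  section_at E p X -> section_at E p Y ->
  section_at E p (fun x => a *: X x + Y x).
Proof.
move=> [U [Uo Up XE]] [V [Vo Vp YE]]; exists (U `&` V).
have UVo : open (U `&` V) by exact: openI.
split=> //; apply: tangent_field_linear => //.
  by apply: tangent_field_sub XE; exact: subIsetl.
by apply: tangent_field_sub YE; exact: subIsetr.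
Qed.

Lemma section_at_sum (R : realType) n (M : manifold R n)
    (E : M -> {vspace 'rV[R]_n}) (p : M) (I : Type) (s : seq I)
    (a : I -> R) (X : I -> M -> 'rV[R]_n) :
  (forall i, section_at E p (X i)) ->
  section_at E p (fun x => \sum_(i <- s) a i *: X i x).
Proof.
move=> XE; elim: s => [|i s IH].
  rewrite (_ : (fun x => _) = fun=> 0); last by apply/funext => x; rewrite big_nil.
  by exists setT; split; [exact: openT| |apply: tangent_field0; exact: openT].
rewrite (_ : (fun x => _) = (fun x => a i *: X i x + \sum_(i <- s) a i *: X i x)).
  exact: section_at_linear.
by apply/funext => x; rewrite big_cons.
Qed.

Lemma section_at_differentiable (R : realType) n (M : manifold R n)
    (E : M -> {vspace 'rV[R]_n}) (p : M) (X : M -> 'rV[R]_n) :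
  section_at E p X -> differentiable (field_in (chart_at p) X) (fwd (chart_at p) p).
Proof.
move=> [U [Uo Up [Xs _]]].
exact: field_in_differentiable Xs (chart_at_atlas p) Up (dom_chart_at p).
Qed.

Lemma field_in_chart_at (R : realType) n (M : manifold R n)
    (X : M -> 'rV[R]_n) (p : M) :
  field_in (chart_at p) X (fwd (chart_at p) p) = X p.
Proof.
have cA : atlas (chart_at p) := chart_at_atlas p.
have cp : dom (chart_at p) p := dom_chart_at p.
by rewrite field_inE // chart_diff_id.
Qed.

Lemma lie_bracketC (R : realType) n (M : manifold R n) (X Y : M -> 'rV[R]_n)
    (p : M) : lie_bracket Y X p = - lie_bracket X Y p.
Proof. by rewrite /lie_bracket /= opprB. Qed.

Lemma lie_bracket_linearl (R : realType) n (M : manifold R n)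
    (X X' Y : M -> 'rV[R]_n) (a : R) (p : M) :
  differentiable (field_in (chart_at p) X) (fwd (chart_at p) p) ->
  differentiable (field_in (chart_at p) X') (fwd (chart_at p) p) ->
  lie_bracket (fun x => a *: X x + X' x) Y p =
  a *: lie_bracket X Y p + lie_bracket X' Y p.
Proof.
move=> dX dX'; apply: etrans (vbracket_linearl _ a dX dX').
by rewrite -field_in_linear.
Qed.

Lemma lie_bracket_suml (R : realType) n (M : manifold R n)
    (E : M -> {vspace 'rV[R]_n}) (p : M) (I : Type) (s : seq I)
    (a : I -> R) (X : I -> M -> 'rV[R]_n) (Y : M -> 'rV[R]_n) :
  (forall i, section_at E p (X i)) ->
  lie_bracket (fun x => \sum_(i <- s) a i *: X i x) Y p =
  \sum_(i <- s) a i *: lie_bracket (X i) Y p.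
Proof.
move=> XE; elim: s => [|i s IH].
  have d0 : differentiable (field_in (chart_at p) (fun=> 0 : 'rV[R]_n))
      (fwd (chart_at p) p).
    apply: (@section_at_differentiable _ _ _ E); exists setT.
    by split=> //; [exact: openT|apply: tangent_field0; exact: openT].
  rewrite big_nil (_ : (fun x => _) = fun x => -1 *: 0 + 0); last first.
    by apply/funext => x; rewrite big_nil scaler0 addr0.
  by rewrite (lie_bracket_linearl _ _ d0 d0) scaleN1r addNr.
rewrite big_cons -IH -lie_bracket_linearl; last 2 first.
- exact: section_at_differentiable (XE i).
- exact: section_at_differentiable (section_at_sum s a XE).
by congr (lie_bracket _ _ _); apply/funext => x; rewrite big_cons.
Qed.

(* If [X p = 0] then [lie_bracket X Y p] is, up to sign, the derivative of [X]
   along [Y p]. *)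
Lemma lie_bracket_vanishing (R : realType) n (M : manifold R n)
    (E : M -> {vspace 'rV[R]_n}) (U : set M) (X Y : M -> 'rV[R]_n) (p : M) :
  smooth_subbundle U E -> U p -> section_at E p X -> X p = 0 ->
  lie_bracket X Y p \in E p.
Proof.
move=> Es Up [V [Vo Vp XE]] Xp.
set c := chart_at p; set z := fwd c p.
have e : 'd (field_in c Y) z (field_in c X z) = 0.
  exact: etrans (f_equal _ (etrans (field_in_chart_at X p) Xp)) (linear0 _).
have -> : lie_bracket X Y p = - 'd (field_in c X) z (field_in c Y z).
  apply: (etrans (f_equal (fun w => w - _) e)).
  by rewrite sub0r.
rewrite memvN; exact: diff_vanishing_section Es Up Vo Vp XE Xp.
Qed.

(** The coefficients [a] are constants, so subtracting the combination of the [Z i] from [X] gives a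
    section vanishing at [p] whose bracket with [Y] is found by linearity. *)
Lemma lie_bracket_expandl (R : realType) n (M : manifold R n)
    (E : M -> {vspace 'rV[R]_n}) (U : set M) (X Y : M -> 'rV[R]_n) (p : M)
    (I : Type) (s : seq I) (a : I -> R) (Z : I -> M -> 'rV[R]_n) :
  smooth_subbundle U E -> U p -> section_at E p X ->
  (forall i, section_at E p (Z i)) -> X p = \sum_(i <- s) a i *: Z i p ->
  lie_bracket X Y p - \sum_(i <- s) a i *: lie_bracket (Z i) Y p \in E p.
Proof.
move=> Es Up XE ZE Xp.
pose S x := \sum_(i <- s) a i *: Z i x.
have SE : section_at E p S by exact: section_at_sum.
have T0 : section_at E p (fun x => -1 *: S x + X x) by exact: section_at_linear.
have := @lie_bracket_vanishing _ _ _ _ _ _ Y _ Es Up T0.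
rewrite scaleN1r Xp addNr => /(_ erefl).
rewrite lie_bracket_linearl; [|exact: section_at_differentiable SE
  |exact: section_at_differentiable XE].
by rewrite (lie_bracket_suml _ _ _ ZE) scaleN1r addrC.
Qed.

(** Lifts of vectors to sections will come from a choice and need not depend linearly on the
    vectors. Keeping [beta] on basis vectors only and extending bilinearly restores linearity, at
    the price of an error in the lower flag. *)
Definition flag_form (R : realType) n (V V' : {vspace 'rV[R]_n})
    (beta : 'rV[R]_n -> 'rV[R]_n -> 'rV[R]_n) (u v : 'rV[R]_n) : 'rV[R]_n :=
  \sum_(a < \dim V) coord (vbasis V) a u *:
  \sum_(b < \dim V') coord (vbasis V') b v *: beta (vbasis V)`_a (vbasis V')`_b.

Lemma flag_form_linearl (R : realType) n (V V' : {vspace 'rV[R]_n}) beta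
    (a : R) (u u' v : 'rV[R]_n) :
  flag_form V V' beta (a *: u + u') v =
  a *: flag_form V V' beta u v + flag_form V V' beta u' v.
Proof.
rewrite /flag_form scaler_sumr -big_split; apply: eq_bigr => i _ /=.
by rewrite linearP scalerDl scalerA.
Qed.

Lemma flag_form_linearr (R : realType) n (V V' : {vspace 'rV[R]_n}) beta
    (a : R) (u v v' : 'rV[R]_n) :
  flag_form V V' beta u (a *: v + v') =
  a *: flag_form V V' beta u v + flag_form V V' beta u v'.
Proof.
rewrite /flag_form scaler_sumr -big_split; apply: eq_bigr => i _ /=.
rewrite scalerA [a * _]mulrC -scalerA -scalerDr; congr (_ *: _).
rewrite scaler_sumr -big_split; apply: eq_bigr => j _ /=.
by rewrite linearP scalerDl scalerA.
Qed.

(** [X] is expanded along the lifts of a basis of [E p], then [Y] along those of a basis of [E' p].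
    The errors lie in [E p] and [E' p], and [W] absorbs them. *)
Lemma lie_bracket_flag_form (R : realType) n (M : manifold R n)
    (E E' : M -> {vspace 'rV[R]_n}) (U : set M) (X Y : M -> 'rV[R]_n) (p : M)
    (S S' : 'rV[R]_n -> M -> 'rV[R]_n) (W : {vspace 'rV[R]_n}) :
  smooth_subbundle U E -> smooth_subbundle U E' -> U p ->
  (E p <= W)%VS -> (E' p <= W)%VS ->
  (forall u, u \in E p -> section_at E p (S u) /\ S u p = u) ->
  (forall u, u \in E' p -> section_at E' p (S' u) /\ S' u p = u) ->
  section_at E p X -> section_at E' p Y ->
  lie_bracket X Y p -
  flag_form (E p) (E' p) (fun u v => lie_bracket (S u) (S' v) p) (X p) (Y p)
    \in W.
Proof.
move=> Es E's Up EW E'W HS HS' XE YE.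
have memb (V : {vspace 'rV[R]_n}) (a : 'I_(\dim V)) : (vbasis V)`_a \in V.
  by apply: vbasis_mem; rewrite mem_nth // size_tuple.
have value G (Z : M -> 'rV[R]_n) : section_at G p Z -> Z p \in G p.
  by move=> [V [_ Vp [_ H]]]; exact: H.
pose Z (a : 'I_(\dim (E p))) := S (vbasis (E p))`_a.
pose Z' (a : 'I_(\dim (E' p))) := S' (vbasis (E' p))`_a.
have ZE a : section_at E p (Z a) by have [] := HS _ (memb _ a).
have Z'E a : section_at E' p (Z' a) by have [] := HS' _ (memb _ a).
have Xp : X p = \sum_(a < \dim (E p)) coord (vbasis (E p)) a (X p) *: Z a p.
  rewrite {1}(coord_vbasis (value _ _ XE)); apply: eq_bigr => a _.
  by rewrite /Z; have [_ ->] := HS _ (memb _ a).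
have Yp : Y p = \sum_(a < \dim (E' p)) coord (vbasis (E' p)) a (Y p) *: Z' a p.
  rewrite {1}(coord_vbasis (value _ _ YE)); apply: eq_bigr => a _.
  by rewrite /Z'; have [_ ->] := HS' _ (memb _ a).
have H1 := subvP EW _ (lie_bracket_expandl Y Es Up XE ZE Xp).
rewrite -(subrKA (\sum_(a < \dim (E p)) coord (vbasis (E p)) a (X p) *:
  lie_bracket (Z a) Y p)) memvD //.
rewrite /flag_form -sumrB memv_suml // => a _; rewrite -scalerBr memvZ //.
have H2 := subvP E'W _ (lie_bracket_expandl (Z a) E's Up YE Z'E Yp).
(* Antisymmetry brings [Y] to the first slot, where [lie_bracket_expandl] applies. *)
rewrite (lie_bracketC Y (Z a)).
rewrite (eq_bigr (fun b => - (coord (vbasis (E' p)) b (Y p) *: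
  lie_bracket (Z' b) (Z a) p))); last first.
  by move=> b _; rewrite (lie_bracketC (Z' b) (Z a)) scalerN.
by rewrite sumrN -opprD memvN.
Qed.

(** * Bracket forms at the fixed point *)

(** The value at index [0] is the convention E^(-1) = 0, in accordance with n_(-1) = 0, so that the
    bottom level is treated as a quotient like the others. *)
Definition flag_pred (K : fieldType) (V : vectType K) (W : nat -> {vspace V})
    (i : nat) : {vspace V} := if i is k.+1 then W k else 0%VS.

(* Lifts to [V] of the bracket maps [W i / W i.-1 -> W j / W j.-1 ->
   W (i + j).+1 / W (i + j)] of the graded Lie algebra, which [A] acts on. *)
Record bracket_forms (K : fieldType) (V : vectType K) (W : nat -> {vspace V})
    (A : 'End(V)) (r : nat) (b : nat -> nat -> V -> V -> V) : Prop := {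
  form_linearl : forall i j a u u' v,
    b i j (a *: u + u') v = a *: b i j u v + b i j u' v;
  form_linearr : forall i j a u v v',
    b i j u (a *: v + v') = a *: b i j u v + b i j u v';
  form_mem : forall i j u v, (i + j < r)%N -> u \in W i -> v \in W j ->
    b i j u v \in W (i + j).+1;
  form_predl : forall i j u v, (i + j < r)%N -> u \in flag_pred W i ->
    v \in W j -> b i j u v \in W (i + j)%N;
  form_predr : forall i j u v, (i + j < r)%N -> u \in W i ->
    v \in flag_pred W j -> b i j u v \in W (i + j)%N;
  form_equivariant : forall i j u v, (i + j < r)%N -> u \in W i -> v \in W j ->
    b i j (A u) (A v) - A (b i j u v) \in W (i + j)%N;
  form_generate : forall k (P : V -> Prop), (k < r)%N ->
    (forall a u v, P u -> P v -> P (a *: u + v)) ->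
    (forall w, w \in W k -> P w) ->
    (forall i j u v, (i + j)%N = k -> u \in W i -> v \in W j -> P (b i j u v)) ->
    forall w, w \in W k.+1 -> P w }.

Definition related_sections (R : realType) n (M : manifold R n)
    (E : M -> {vspace 'rV[R]_n}) (f : M -> M) (U0 : set M) (p : M) (i : nat)
    (X X' : M -> 'rV[R]_n) : Prop :=
  exists U : set M,
    [/\ open U, U p, U `<=` U0 & tangent_field (flag E i) U X] /\
    [/\ open (f @` U), tangent_field (flag E i) (f @` U) X' &
        forall x, U x -> X' (f x) = tangent_map f x (X x)].

Lemma open_image (T T' : topologicalType) (f : T -> T') (g : T' -> T)
    (U0 U : set T) : open (f @` U0) ->
  (forall y, (f @` U0) y -> {for y, continuous g}) ->
  (forall x, U0 x -> g (f x) = x) -> U `<=` U0 -> open U -> open (f @` U).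
Proof.
move=> fU0 gc gK UU0 Uo.
have -> : f @` U = f @` U0 `&` g @^-1` U.
  apply/seteqP; split=> [_ [x Ux <-]|_ [[x U0x <-] /=]].
    by split; [exists x => //; exact: UU0|rewrite /= gK //; exact: UU0].
  by rewrite gK // => Ux; exists x.
exact: open_preimage_on.
Qed.

Lemma smooth_map_sub (R : realType) m n (M : manifold R m) (N : manifold R n)
    (U U' : set M) (f : M -> N) : U' `<=` U -> smooth_map U f -> smooth_map U' f.
Proof.
move=> UU' [fc fs]; split=> [x /UU'|c d cA dA k]; first exact: fc.
by apply: Ck_on_sub (fs c d cA dA k) => _ [x [[cx /UU' Ux] dx] <-]; exists x.
Qed.

(** [set_span_ind] reduces to values of iterated brackets, whose partner comes from
    [pushforward_iterated_bracket]; linear combinations only shrink the neighbourhood. When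
    [f p = p] the pair lifts a vector and its image at the same point. *)
Lemma related_sections_exist (R : realType) n (M : manifold R n)
    (E : M -> {vspace 'rV[R]_n}) (f g : M -> M) (U0 : set M) (p : M) (i : nat)
    (u : 'rV[R]_n) : open U0 -> U0 p -> open (f @` U0) -> smooth_map U0 f ->
  smooth_map (f @` U0) g -> (forall x, U0 x -> g (f x) = x) ->
  (forall x, (tangent_map f x @: E x <= E (f x))%VS) ->
  u \in flag E i p ->
  exists X X', related_sections E f U0 p i X X' /\ X p = u.
Proof.
move=> U0o U0p fU0 fs gs gK fE.
have op U : U `<=` U0 -> open U -> open (f @` U).
  by case: gs => gc _ UU0 Uo; exact: (open_image fU0 gc gK UU0 Uo).
apply: (@set_span_ind _ _ _ (fun u => exists X X',
  related_sections E f U0 p i X X' /\ X p = u)).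
- exists (fun=> 0), (fun=> 0); split=> //; exists U0; split; split=> //.
  + exact: tangent_field0.
  + exact: tangent_field0.
  + by move=> x _; rewrite linear0.
- move=> a v1 v2 [X [X' [[U [[Uo Up UU0 XE] [fUo XE' rel]]] Xp]]].
  move=> [Y [Y' [[V [[Vo Vp VU0 YE] [fVo YE' rel']]] Yp]]].
  exists (fun x => a *: X x + Y x), (fun x => a *: X' x + Y' x).
  rewrite Xp Yp; split=> //.
  have UVo : open (U `&` V) by exact: openI.
  have UV0 : U `&` V `<=` U0 by move=> x [/UU0].
  have fUVo := op _ UV0 UVo.
  exists (U `&` V); split; split=> //.
  + apply: tangent_field_linear => //.
      by apply: tangent_field_sub XE; exact: subIsetl.
    by apply: tangent_field_sub YE; exact: subIsetr.
  + apply: tangent_field_linear => //.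
      by apply: tangent_field_sub XE' => _ [x [Ux _] <-]; exists x.
    by apply: tangent_field_sub YE' => _ [x [_ Vx] <-]; exists x.
  + by move=> x [Ux Vx]; rewrite linearP rel // rel'.
- move=> v [U [k [X [Uo Up ki HX ->]]]].
  have UVo : open (U `&` U0) by exact: openI.
  have UV0 : U `&` U0 `<=` U0 by move=> x [].
  have fUVo := op _ UV0 UVo.
  have HX' := iterated_bracket_sub (@subIsetl _ U U0) HX.
  have gs' : smooth_map (f @` (U `&` U0)) g.
    by apply: smooth_map_sub gs => _ [x [_ U0x] <-]; exists x.
  have [X' HXX' rel] := pushforward_iterated_bracket UVo fUVo
    (smooth_map_sub UV0 fs) gs' (fun x Hx => gK x (UV0 x Hx)) (fun x _ => fE x) HX'.
  exists X, X'; split=> //; exists (U `&` U0); split; split=> //.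
  + exact: iterated_bracket_tangent HX'.
  + exact: iterated_bracket_tangent HXX'.
Qed.

(** Everything rests on [bP]: for [i + j < r] the form computes the bracket of any two sections
    modulo E^(i+j). The bound keeps [i] and [j] in the range where genericity provides smooth
    subbundles. *)
Lemma exists_bracket_forms (R : realType) n (M : manifold R n)
    (E : M -> {vspace 'rV[R]_n}) (f : M -> M) (p : M) (r : nat) :
  generic_at E r p -> local_diffeomorphism f ->
  (forall x, (tangent_map f x @: E x <= E (f x))%VS) -> f p = p ->
  (forall i u, u \in flag E i p -> tangent_map f p u \in flag E i p) /\
  exists b, bracket_forms (fun i => flag E i p) (tangent_map f p) r b.
Proof.
move=> [U [Uo Up Es _ _]] fd fE fp.
have [U0 [g [[U0o U0p] fU0 fs gs gK]]] := fd p.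
have lift i u := @related_sections_exist _ _ _ _ _ _ _ _ i u U0o U0p fU0 fs gs gK fE.
have [S HS] : exists S : nat -> 'rV[R]_n -> (M -> 'rV[R]_n) * (M -> 'rV[R]_n),
    forall i u, u \in flag E i p ->
    related_sections E f U0 p i (S i u).1 (S i u).2 /\ (S i u).1 p = u.
  have /choice[S HS] : forall iu : nat * 'rV[R]_n,
      exists XX : (M -> 'rV[R]_n) * (M -> 'rV[R]_n), iu.2 \in flag E iu.1 p ->
      related_sections E f U0 p iu.1 XX.1 XX.2 /\ XX.1 p = iu.2.
    move=> [i u] /=; have [ui|] := boolP (u \in flag E i p); last first.
      by exists (fun=> 0, fun=> 0).
    by have [X [X' H]] := lift i u ui; exists (X, X').
  by exists (fun i u => S (i, u)) => i u; exact: (HS (i, u)).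
have sec i u : u \in flag E i p ->
    section_at (flag E i) p (S i u).1 /\ (S i u).1 p = u.
  by move=> ui; have [[V [[Vo Vp _ VE] _]] e] := HS i u ui; split=> //; exists V.
have sec' i u : u \in flag E i p ->
    section_at (flag E i) p (S i u).2 /\ (S i u).2 p = tangent_map f p u.
  move=> ui; have [[V [[Vo Vp _ _] [fVo VE' rel]]] e] := HS i u ui; split.
    by exists (f @` V); split=> //; exists p.
  by rewrite -[in LHS]fp rel // e.
have value i Z : section_at (flag E i) p Z -> Z p \in flag E i p.
  by move=> [V [_ Vp [_ H]]]; exact: H.
have inv i u : u \in flag E i p -> tangent_map f p u \in flag E i p.
  by move=> ui; have [/value + e] := sec' i u ui; rewrite e.
split=> //.
pose b i j := flag_form (flag E i p) (flag E j p)
  (fun u v => lie_bracket (S i u).1 (S j v).1 p).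
have bP i j X Y : (i + j < r)%N -> section_at (flag E i) p X ->
    section_at (flag E j) p Y ->
    lie_bracket X Y p - b i j (X p) (Y p) \in flag E (i + j) p.
  move=> ijr XE YE.
  have lei : (i <= r)%N by rewrite (leq_trans (leq_addr j i)) // ltnW.
  have lej : (j <= r)%N by rewrite (leq_trans (leq_addl i j)) // ltnW.
  exact: (lie_bracket_flag_form (Es i lei) (Es j lej) Up
    (flag_subv E p (leq_addr j i)) (flag_subv E p (leq_addl i j))
    (sec i) (sec j) XE YE).
have lin1 i j a u u' v : b i j (a *: u + u') v = a *: b i j u v + b i j u' v.
  exact: flag_form_linearl.
have lin2 i j a u v v' : b i j u (a *: v + v') = a *: b i j u v + b i j u v'.
  exact: flag_form_linearr.
have z1 i j v : b i j 0 v = 0.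
  by have := lin1 i j (-1) 0 0 v; rewrite scaler0 addr0 scaleN1r addNr.
have z2 i j u : b i j u 0 = 0.
  by have := lin2 i j (-1) u 0 0; rewrite scaler0 addr0 scaleN1r addNr.
have modW (i : nat) (w w' : 'rV[R]_n) k : (i <= k)%N -> w - w' \in flag E i p ->
    (w \in flag E k p) = (w' \in flag E k p).
  move=> ik /(subvP (flag_subv E p ik)) ww'; apply/idP/idP => H.
    by rewrite -[w'](subrK w) memvD // -memvN opprB.
  by rewrite -[w](subrK w') memvD.
(* By bilinearity it is enough to take values of iterated brackets. There the form is, modulo
   E^(i+j), the bracket of fields with at most [i] and [j] operations, hence of a field with at most
   [(i + j).+1]. *)
have bmem i j u v : (i + j < r)%N -> u \in flag E i p -> v \in flag E j p ->
    b i j u v \in flag E (i + j).+1 p.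
  move=> ijr ui vj; move: u ui.
  apply: (@set_span_ind _ _ _ (fun u => b i j u v \in flag E (i + j).+1 p)).
  - by rewrite z1 mem0v.
  - by move=> a u u' Hu Hu'; rewrite lin1 memvD ?memvZ.
  move=> _ [V [k [X [Vo Vp ki HX ->]]]].
  move: v vj.
  apply: (@set_span_ind _ _ _ (fun v => b i j (X p) v \in flag E (i + j).+1 p)).
  - by rewrite z2 mem0v.
  - by move=> a v v' Hv Hv'; rewrite lin2 memvD ?memvZ.
  move=> _ [V' [k' [Y [V'o V'p k'j HY ->]]]].
  have XE : section_at (flag E i) p X.
    by exists V; split=> //; exact: iterated_bracket_tangent HX.
  have YE : section_at (flag E j) p Y.
    by exists V'; split=> //; exact: iterated_bracket_tangent HY.
  rewrite -(modW _ _ _ _ (leqnSn _) (bP _ _ _ _ ijr XE YE)).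
  apply: (@mem_flag _ _ _ _ (V `&` V') (k + k').+1) => //.
  + exact: openI.
  + by rewrite ltnS leq_add.
  + apply: iterated_bracketS.
      by apply: iterated_bracket_sub HX; exact: subIsetl.
    by apply: iterated_bracket_sub HY; exact: subIsetr.
have secS i X : section_at (flag E i) p X -> section_at (flag E i.+1) p X.
  move=> [V [Vo Vp [Xs XE]]]; exists V; split=> //; split=> // x Vx.
  by apply: (subvP (flag_subv E x (leqnSn i))); exact: XE.
exists b; split=> //.
(* The lift of [u] at level [i] is also a section at level [i.+1], so one bracket is computed by
   both forms. The form of the smaller index already takes its value in the required level. *)
- move=> [|i] j u v ijr /=; first by rewrite memv0 => /eqP -> _; rewrite z1 mem0v.
  move=> ui vj; have [Xs Xp] := sec i u ui; have [Ys Yp] := sec j v vj.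
  have H1 := bP _ _ _ _ ijr (secS _ _ Xs) Ys.
  have H2 := bP _ _ _ _ (ltnW ijr) Xs Ys.
  rewrite Xp Yp in H1 H2.
  rewrite -(modW _ _ _ _ (leqnn _) H1) (modW _ _ _ _ (leqnSn _) H2).
  exact: bmem (ltnW ijr) ui vj.
- move=> i [|j] u v ijr ui /=; first by rewrite memv0 => /eqP ->; rewrite z2 mem0v.
  move=> vj; have [Xs Xp] := sec i u ui; have [Ys Yp] := sec j v vj.
  have H1 := bP _ _ _ _ ijr Xs (secS _ _ Ys).
  have ijr' : (i + j < r)%N by rewrite addnS in ijr; exact: ltnW.
  have H2 := bP _ _ _ _ ijr' Xs Ys.
  rewrite Xp Yp in H1 H2.
  rewrite -(modW _ _ _ _ (leqnn _) H1) addnS (modW _ _ _ _ (leqnSn _) H2).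
  exact: bmem ijr' ui vj.
(* The lifts of [u] and [v] are related by [f] to lifts of their images, so naturality at the fixed
   point gives the equation up to two errors of [bP]. One of them is moved by the differential,
   which preserves the flag. *)
- move=> i j u v ijr ui vj.
  have [[V [[Vo Vp VU0 XE] [fVo XE' Xrel]]] Xp] := HS i u ui.
  have [[V' [[V'o V'p V'U0 YE] [fV'o YE' Yrel]]] Yp] := HS j v vj.
  have [Xs Xe] := sec i u ui; have [Ys Ye] := sec j v vj.
  have [Xs' Xe'] := sec' i u ui; have [Ys' Ye'] := sec' j v vj.
  have Wo : open (V `&` V') by exact: openI.
  have WU0 : V `&` V' `<=` U0 by move=> x [/VU0].
  have fWp : (f @` V `&` f @` V') (f p) by split; exists p.
  have rel : lie_bracket (S i u).2 (S j v).2 (f p) =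
      tangent_map f p (lie_bracket (S i u).1 (S j v).1 p).
    apply: (lie_bracket_related Wo (smooth_map_sub WU0 fs) (conj Vp V'p) fWp).
    + by apply: smooth_field_sub (proj1 XE); exact: subIsetl.
    + by apply: smooth_field_sub (proj1 YE); exact: subIsetr.
    + by apply: smooth_field_sub (proj1 XE'); exact: subIsetl.
    + by apply: smooth_field_sub (proj1 YE'); exact: subIsetr.
    + by move=> x [Vx _]; exact: Xrel.
    + by move=> x [_ Vx]; exact: Yrel.
  have H1 := bP _ _ _ _ ijr Xs Ys; rewrite Xe Ye in H1.
  have H2 := bP _ _ _ _ ijr Xs' Ys'; rewrite Xe' Ye' in H2.
  rewrite fp in rel; rewrite rel in H2.
  have := inv _ _ H1; rewrite linearB => H3.
  rewrite -(subrKA (tangent_map f p (lie_bracket (S i u).1 (S j v).1 p))) memvD //.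
  by rewrite -memvN opprB.
- move=> k P kr PD PW Pb.
  apply: set_span_ind.
  + exact/PW/mem0v.
  + exact: PD.
  move=> _ [V [l [X [Vo Vp lk HX ->]]]].
  (* With at most [k] operations the value is already in level [k]. With exactly [k.+1], the
     outermost bracket joins fields with [i] and [j] operations, where [i + j = k]. *)
  move: lk; rewrite leq_eqVlt => /orP[/eqP lk|lk]; last first.
    by apply: PW; apply: mem_flag HX.
  case: HX lk => // i j X1 X2 HX1 HX2 [ijk].
  have X1E : section_at (flag E i) p X1.
    by exists V; split=> //; exact: iterated_bracket_tangent HX1.
  have X2E : section_at (flag E j) p X2.
    by exists V; split=> //; exact: iterated_bracket_tangent HX2.
  have ijr : (i + j < r)%N by rewrite ijk.
  have := bP _ _ _ _ ijr X1E X2E; rewrite ijk => /PW.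
  have := Pb _ _ _ _ ijk (value _ _ X1E) (value _ _ X2E).
  by move=> P1 P2; have := PD 1 _ _ P2 P1; rewrite scale1r subrK.
Qed.

(** * Eigenvalues on the graded space *)

Lemma char_poly_lblock (F : fieldType) d m (A : 'M[F]_d) (C : 'M[F]_(m, d))
    (D : 'M[F]_m) : char_poly (block_mx A 0 C D) = char_poly A * char_poly D.
Proof.
rewrite /char_poly /char_poly_mx map_block_mx scalar_mx_block opp_block_mx.
by rewrite add_block_mx map_mx0 oppr0 addr0 det_lblock.
Qed.

Lemma char_poly_conj (F : fieldType) n (P A B : 'M[F]_n) :
  P \in unitmx -> P *m A = B *m P -> char_poly A = char_poly B.
Proof.
move=> Pu PA; pose Q := map_mx polyC P.
have Qu : \det Q != 0.
  by rewrite det_map_mx polyC_eq0 -unitfE -unitmxE.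
apply: (mulfI Qu); rewrite [RHS]mulrC -!det_mulmx; congr (\det _).
by rewrite mulmxBr mulmxBl scalar_mxC -!map_mxM PA.
Qed.

(** Endomorphisms act here on row coordinates, so that columns are covectors. Transposing turns the
    row vectors of [eigenvalue] into eigencovectors and leaves the characteristic polynomial
    unchanged. *)
Lemma root_char_polyP (F : fieldType) n (A : 'M[F]_n) (z : F) :
  root (char_poly A) z <-> exists2 x : 'cV[F]_n, x != 0 & A *m x = z *: x.
Proof.
have -> : char_poly A = char_poly A^T.
  rewrite /char_poly -[RHS]det_tr; congr (\det _).
  by rewrite /char_poly_mx linearB /= tr_scalar_mx map_trmx trmxK.
rewrite -eigenvalue_root_char; split.
  move=> /eigenvalueP[v vA v0]; exists v^T; first by rewrite trmx_eq0.
  by rewrite -[A]trmxK -trmx_mul vA linearZ.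
move=> [x x0 Ax]; apply/eigenvalueP; exists x^T; last by rewrite trmx_eq0.
by rewrite -trmx_mul Ax linearZ.
Qed.

(** Completing the rows of [J] to an invertible [P] conjugates [M] to a lower block triangular
    matrix with diagonal blocks [M'] and [D], where [D] represents the quotient map. A covector
    killed by [J] becomes a column with zero upper block. *)
Lemma quotient_char_poly (F : fieldType) d e (J : 'M[F]_(d, e)) (M : 'M[F]_e)
    (M' : 'M[F]_d) : row_free J -> J *m M = M' *m J ->
  exists m (D : 'M[F]_m), char_poly M = char_poly M' * char_poly D /\
    forall z, root (char_poly D) z <->
      exists2 y : 'cV[F]_e, y != 0 & J *m y = 0 /\ M *m y = z *: y.
Proof.
move=> Jf JM; have [m em] : exists m, e = (d + m)%N.
  by exists (e - d)%N; rewrite subnKC // -(eqP Jf) rank_leq_col.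
subst e; exists m.
(* As [J] has full rank, its rows span the same space as the first [d] rows of [row_ebase J]; the
   remaining rows complete them to a basis. *)
pose K := dsubmx (row_ebase J); pose P := col_mx J K.
have JE : J = col_ebase J *m usubmx (row_ebase J).
  rewrite -{1}(mulmx_ebase J) -mulmxA; congr (_ *m _).
  rewrite (eqP Jf) -{1}(vsubmxK (row_ebase J)).
  by rewrite pid_mx_row mul_row_col mul1mx mul0mx addr0.
have Pu : P \in unitmx.
  have -> : P = block_mx (col_ebase J) 0 0 1%:M *m row_ebase J.
    rewrite -[row_ebase J in RHS]vsubmxK mul_block_col !mul0mx mul1mx addr0 add0r.
    by rewrite -JE.
  rewrite unitmx_mul row_ebase_unit andbT unitmxE det_ublock det1 mulr1.
  by rewrite -unitmxE col_ebase_unit.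
pose Q := P *m M *m invmx P; pose D := drsubmx Q.
have uQ : usubmx Q = row_mx M' 0.
  rewrite /Q -mulmxA {1}/P mul_col_mx col_mxKu mulmxA JM -mulmxA.
  have -> : J = usubmx P by rewrite col_mxKu.
  rewrite mul_usub_mx mulmxV // scalar_mx_block /block_mx col_mxKu.
  by rewrite mul_mx_row mulmx1 mulmx0.
have QE : Q = block_mx M' 0 (dlsubmx Q) D.
  rewrite -[LHS]vsubmxK uQ; congr col_mx.
  by rewrite -[dsubmx Q]hsubmxK.
have PM : P *m M = Q *m P by rewrite mulmxKV.
exists D; split; first by rewrite (char_poly_conj Pu PM) QE char_poly_lblock.
move=> z; apply: iff_trans (root_char_polyP D z) _; split.
  move=> [x x0 Dx]; exists (invmx P *m col_mx 0 x).
    apply: contra_neq x0 => /(congr1 (mulmx P)).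
    by rewrite mulKVmx // mulmx0 -[0 in X in _ = X](@col_mx0 _ d m 1) => /eq_col_mx[].
  have Py : P *m (invmx P *m col_mx 0 x) = col_mx 0 x by rewrite mulKVmx.
  split.
    by move: Py; rewrite {1}/P mul_col_mx => /eq_col_mx[].
  apply: (can_inj (mulKmx Pu)); rewrite mulmxA PM -mulmxA Py -scalemxAr Py.
  by rewrite QE mul_block_col !mulmx0 mul0mx !add0r Dx scale_col_mx scaler0.
move=> [y y0 [Jy My]]; exists (K *m y).
  apply: contra_neq y0 => Ky; apply: (can_inj (mulKmx Pu)).
  by rewrite mulmx0 mul_col_mx Jy Ky col_mx0.
have : P *m (M *m y) = z *: (P *m y) by rewrite My scalemxAr.
rewrite mulmxA PM -mulmxA mul_col_mx Jy QE mul_block_col !mulmx0 mul0mx !add0r.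
by rewrite scale_col_mx => /eq_col_mx[].
Qed.

(** By Cayley-Hamilton, multiplying [B] on the right by the successive factors of the characteristic
    polynomial of [T = M2^T] ends at zero. The last nonzero product satisfies [B *m T = beta *: B];
    its nonzero rows, transposed, are eigencovectors of [M2], and its nonzero columns are the
    vectors [x]. The conclusion on [x] is stated without division so as to cover [beta = 0]. *)
Lemma form_eigenvectors (C : closedFieldType) d1 d2 e1 e2 (M1 : 'M[C]_e1)
    (M2 : 'M[C]_e2) (J1 : 'M[C]_(d1, e1)) (J2 : 'M[C]_(d2, e2)) (N2 : 'M[C]_d2)
    (B : 'M[C]_(e1, e2)) (z : C) :
  J2 *m M2 = N2 *m J2 -> B != 0 -> M1 *m B *m M2^T = z *: B ->
  J1 *m B = 0 -> B *m J2^T = 0 ->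
  exists beta,
    (exists2 y : 'cV[C]_e2, y != 0 & J2 *m y = 0 /\ M2 *m y = beta *: y) /\
    (exists2 x : 'cV[C]_e1, x != 0 & J1 *m x = 0 /\ beta *: (M1 *m x) = z *: x).
Proof.
(* If [e2 = 0] then [B] is zero; otherwise the size is a successor, which gives the ring of square
   matrices used by [horner_mx]. *)
case: e2 M2 J2 B => [|n] M2 J2 B; first by rewrite [B]thinmx0 eqxx.
move=> JM; pose T := M2^T.
have [s sE] : exists s, char_poly T = \prod_(w <- s) ('X - w%:P).
  have [s sE] := closed_field_poly_normal (char_poly T); exists s.
  by rewrite sE (monicP (char_poly_monic T)) scale1r.
have : B *m horner_mx T (\prod_(w <- s) ('X - w%:P)) = 0.
  by rewrite -sE Cayley_Hamilton mulmx0.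
elim: s B {sE} => [|beta s IH] B.
  by rewrite big_nil rmorph1 mulmx1 => ->; rewrite eqxx.
rewrite big_cons rmorphM rmorphB /= horner_mx_X horner_mx_C => Bs B0 MB JB BJ.
pose B' := B *m (T - beta%:M).
have BT : B' = B *m T - beta *: B by rewrite /B' mulmxBr mul_mx_scalar.
(* If this factor does not kill [B], the induction continues with [B']: the factor commutes with
   [T], and [J2] intertwines [M2] and [N2], so all the hypotheses persist. *)
have [B'0|B'0] := eqVneq B' 0; last first.
  apply: (IH B') => //.
  - by rewrite /B' -mulmxA.
  - rewrite /B' mulmxA -mulmxA -/T.
    have -> : (T - beta%:M) *m T = T *m (T - beta%:M).
      by rewrite mulmxBl mulmxBr scalar_mxC.
    by rewrite mulmxA MB scalemxAl.
  - by rewrite /B' mulmxA JB mul0mx.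
  - rewrite BT mulmxBl -scalemxAl BJ scaler0 subr0 -mulmxA /T -trmx_mul JM.
    by rewrite trmx_mul mulmxA BJ mul0mx.
exists beta; move/eqP: BT; rewrite B'0 eq_sym subr_eq0 => /eqP BT.
have [i [j Bij]] : exists i j, B i j != 0.
  apply/not_existsP => H; move/eqP: B0; apply; apply/matrixP => i j.
  by rewrite mxE; apply/eqP/negPn/negP => Bij; apply: (H i); exists j.
split.
  exists (row i B)^T.
    by apply: contra_neq Bij => /(congr1 (fun M : 'cV[C]_n.+1 => M j 0)); rewrite !mxE.
  split; apply: trmx_inj; rewrite trmx_mul trmxK.
    by rewrite -row_mul BJ row0 trmx0.
  by rewrite -row_mul BT linearZ [RHS]linearZ /= trmxK.
exists (col j B).
  by apply: contra_neq Bij => /(congr1 (fun M : 'cV[C]_e1 => M i 0)); rewrite !mxE.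
rewrite colE; split; first by rewrite mulmxA JB mul0mx.
have MBb : beta *: (M1 *m B) = z *: B.
  by rewrite -MB -mulmxA -/T BT scalemxAr.
by rewrite mulmxA scalemxAl MBb -scalemxAl.
Qed.

(** * Covectors, restrictions and quotients in bases *)

(** For [U] inside [W], multiplying a column by this matrix restricts a covector from [W] to [U]. *)
Definition inclusion_mx (K : fieldType) (V : vectType K) (U W : {vspace V}) :
    'M[K]_(\dim U, \dim W) := \matrix_(i, j) coord (vbasis W) j (vbasis U)`_i.

Lemma mem_vbasis_nth (K : fieldType) (V : vectType K) (U : {vspace V})
    (i : 'I_(\dim U)) : (vbasis U)`_i \in U.
Proof. by apply: vbasis_mem; rewrite mem_nth // size_tuple. Qed.

Lemma inclusion_mx_free (K : fieldType) (V : vectType K) (U W : {vspace V}) :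
  (U <= W)%VS -> row_free (inclusion_mx U W).
Proof.
move=> UW; apply: inj_row_free => w w0.
have /freeP fr := basis_free (vbasisP U).
have : \sum_(i < \dim U) w 0 i *: (vbasis U)`_i = 0.
  have cw (i : 'I_(\dim U)) := coord_vbasis (subvP UW _ (mem_vbasis_nth i)).
  rewrite (eq_bigr (fun i => \sum_(j < \dim W) (w 0 i * inclusion_mx U W i j) *:
    (vbasis W)`_j)); last first.
    move=> i _; rewrite {1}(cw i) scaler_sumr; apply: eq_bigr => j _.
    by rewrite scalerA mxE.
  rewrite exchange_big big1 //= => j _; rewrite -scaler_suml.
  have := congr1 (fun M : 'rV[K]_(\dim W) => M 0 j) w0; rewrite !mxE => ->.
  by rewrite scale0r.
by move=> /fr w1; apply/rowP => i; rewrite mxE w1.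
Qed.

Lemma inclusion_mx_restriction (K : fieldType) (V : vectType K)
    (U W : {vspace V}) (A : 'End(V)) :
  (U <= W)%VS -> (forall u, u \in U -> A u \in U) ->
  (forall u, u \in W -> A u \in W) ->
  inclusion_mx U W *m restriction_mx W A = restriction_mx U A *m inclusion_mx U W.
Proof.
move=> UW AU AW; apply/matrixP => i j; rewrite !mxE.
transitivity (coord (vbasis W) j (A (vbasis U)`_i)).
  rewrite [in RHS](coord_vbasis (subvP UW _ (mem_vbasis_nth i))) !linear_sum /=.
  by apply: eq_bigr => k _; rewrite !linearZ /= !mxE.
rewrite {1}(coord_vbasis (AU _ (mem_vbasis_nth i))) linear_sum /=.
by apply: eq_bigr => k _; rewrite linearZ /= !mxE.
Qed.

(* [z] is an eigenvalue of the map induced by [A] on [W / U]; the witness [y] is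
   a covector on [W] vanishing on [U], in the basis dual to [vbasis W]. *)
Definition quotient_eigenvalue (R : rcfType) (V : vectType R)
    (U W : {vspace V}) (A : 'End(V)) (z : R[i]) : Prop :=
  exists2 y : 'cV[R[i]]_(\dim W), y != 0 &
    map_mx (real_complex R) (inclusion_mx U W) *m y = 0 /\
    map_mx (real_complex R) (restriction_mx W A) *m y = z *: y.

(** The characteristic polynomial on [W] is the one on [U] times that of the quotient map. Since a
    split polynomial determines its roots with multiplicity, the part [s] cancels and [t] comes from
    the roots [nu] of the second factor. *)
Lemma lyapunov_exponents_quotient (R : realType) (V : vectType R)
    (U W : {vspace V}) (A : 'End(V)) (s t : seq R) :
  (U <= W)%VS -> (forall u, u \in U -> A u \in U) ->
  (forall u, u \in W -> A u \in W) ->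
  lyapunov_exponents U A s -> lyapunov_exponents W A (s ++ t) ->
  exists2 nu : seq R[i], perm_eq t [seq ln (Normc.normc z) | z <- nu] &
    forall z, z \in nu <-> quotient_eigenvalue U W A z.
Proof.
move=> UW AU AW [mu1 E1 P1] [mu2 E2 P2].
have Jf : row_free (map_mx (real_complex R) (inclusion_mx U W)).
  by rewrite row_free_map inclusion_mx_free.
have JM : map_mx (real_complex R) (inclusion_mx U W) *m
    map_mx (real_complex R) (restriction_mx W A) =
    map_mx (real_complex R) (restriction_mx U A) *m
    map_mx (real_complex R) (inclusion_mx U W).
  by rewrite -!map_mxM inclusion_mx_restriction.
have [m [D [ED rD]]] := quotient_char_poly Jf JM.
rewrite -!map_char_poly E1 E2 in ED.
have [nu nuE] := closed_field_poly_normal (char_poly D).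
rewrite (monicP (char_poly_monic D)) scale1r in nuE.
exists nu; last first.
  by move=> z; apply: iff_trans (rD z); rewrite nuE root_prod_XsubC.
have : perm_eq mu2 (mu1 ++ nu).
  by apply: prod_XsubC_eq; rewrite big_cat /= -nuE.
move=> /(perm_map (fun z => ln (Normc.normc z))); rewrite map_cat => P3.
rewrite -(perm_cat2l s); apply: (perm_trans P2); apply: (perm_trans P3).
by rewrite perm_cat2r perm_sym.
Qed.

Lemma lyapunov_exponents0 (R : realType) (V : vectType R) (A : 'End(V)) :
  lyapunov_exponents 0%VS A [::].
Proof.
exists [::] => //; rewrite big_nil.
move: (restriction_mx _ _); rewrite dimv0 => M.
by rewrite /char_poly det_mx00 rmorph1.
Qed.

(** This is the covector [y] as a function that is real-linear on all of [V]; only its values on [W]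
    are meaningful, as those of [coord] off the span are not. *)
Definition functional (R : rcfType) (V : vectType R) (W : {vspace V})
    (y : 'cV[R[i]]_(\dim W)) (v : V) : R[i] :=
  \sum_c (coord (vbasis W) c v)%:C%C * y c 0.

Lemma functional_linear (R : rcfType) (V : vectType R) (W : {vspace V})
    (y : 'cV[R[i]]_(\dim W)) (a : R) (u v : V) :
  functional y (a *: u + v) = a%:C%C * functional y u + functional y v.
Proof.
rewrite /functional mulr_sumr -big_split; apply: eq_bigr => c _ /=.
by rewrite linearP rmorphD rmorphM mulrDl mulrA.
Qed.

Lemma functional0 (R : rcfType) (V : vectType R) (W : {vspace V})
    (y : 'cV[R[i]]_(\dim W)) : functional y 0 = 0.
Proof. by rewrite /functional big1 // => c _; rewrite linear0 rmorph0 mul0r. Qed.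

Lemma functional_sum (R : rcfType) (V : vectType R) (W : {vspace V})
    (y : 'cV[R[i]]_(\dim W)) (I : Type) (s : seq I) (a : I -> R) (w : I -> V) :
  functional y (\sum_(i <- s) a i *: w i) =
  \sum_(i <- s) (a i)%:C%C * functional y (w i).
Proof.
elim: s => [|i s IH]; first by rewrite !big_nil functional0.
by rewrite !big_cons functional_linear IH.
Qed.

Lemma functional_basis (R : rcfType) (V : vectType R) (W : {vspace V})
    (y : 'cV[R[i]]_(\dim W)) (c : 'I_(\dim W)) : functional y (vbasis W)`_c = y c 0.
Proof.
rewrite /functional (bigD1 c) //= coord_free ?eqxx ?mul1r; last first.
  exact: basis_free (vbasisP W).
rewrite big1 ?addr0 // => d dc; rewrite coord_free; last exact: basis_free (vbasisP W).
by rewrite eq_sym (negbTE dc) mul0r.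
Qed.

Lemma functional_eq0 (R : rcfType) (V : vectType R) (W : {vspace V})
    (y : 'cV[R[i]]_(\dim W)) : (forall w, w \in W -> functional y w = 0) -> y = 0.
Proof.
move=> H; apply/colP => c.
by rewrite mxE -functional_basis H // mem_vbasis_nth.
Qed.

Lemma inclusion_functional (R : rcfType) (V : vectType R) (U W : {vspace V})
    (y : 'cV[R[i]]_(\dim W)) :
  map_mx (real_complex R) (inclusion_mx U W) *m y = 0 ->
  forall u, u \in U -> functional y u = 0.
Proof.
move=> Jy u uU; rewrite (coord_vbasis uU) functional_sum big1 // => a _.
have -> : functional y (vbasis U)`_a = 0; last by rewrite mulr0.
have := congr1 (fun M : 'cV[R[i]]_(\dim U) => M a 0) Jy; rewrite !mxE => <-.
by apply: eq_bigr => c _; rewrite !mxE.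
Qed.

Lemma restriction_functional (R : rcfType) (V : vectType R) (W : {vspace V})
    (A : 'End(V)) (y : 'cV[R[i]]_(\dim W)) (z : R[i]) :
  map_mx (real_complex R) (restriction_mx W A) *m y = z *: y ->
  forall w, w \in W -> functional y (A w) = z * functional y w.
Proof.
move=> My w wW; rewrite (coord_vbasis wW) linear_sum functional_sum mulr_sumr.
rewrite (eq_bigr (fun a => coord (vbasis W) a w *: A (vbasis W)`_a)); last first.
  by move=> a _; rewrite linearZ.
rewrite functional_sum; apply: eq_bigr => a _.
rewrite mulrCA; congr (_ * _); rewrite functional_basis.
have := congr1 (fun M : 'cV[R[i]]_(\dim W) => M a 0) My; rewrite !mxE => <-.
by apply: eq_bigr => c _; rewrite !mxE.
Qed.

(** Taking restriction, inclusion, identity or coordinate matrices for [X] and [Y] turns each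
    property of a bilinear form into one of its matrix on bases. *)
Lemma form_mx (R : rcfType) (V : vectType R) (g : V -> V -> R[i]) m1 m2 n1 n2
    (w w' : nat -> V) (X : 'M[R]_(m1, n1)) (Y : 'M[R]_(m2, n2)) i j :
  (forall a u u' v, g (a *: u + u') v = a%:C%C * g u v + g u' v) ->
  (forall a u v v', g u (a *: v + v') = a%:C%C * g u v + g u v') ->
  (map_mx (real_complex R) X *m (\matrix_(c < n1, d < n2) g (w c) (w' d)) *m
    (map_mx (real_complex R) Y)^T) i j =
  g (\sum_(c < n1) X i c *: w c) (\sum_(d < n2) Y j d *: w' d).
Proof.
move=> g1 g2.
have z1 v : g 0 v = 0.
  by have := g1 (-1) 0 0 v; rewrite scaler0 addr0 rmorphN rmorph1 mulN1r addNr.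
have z2 u : g u 0 = 0.
  by have := g2 (-1) u 0 0; rewrite scaler0 addr0 rmorphN rmorph1 mulN1r addNr.
have s1 (s : seq 'I_n1) v : g (\sum_(c <- s) X i c *: w c) v =
    \sum_(c <- s) (X i c)%:C%C * g (w c) v.
  by elim: s => [|c s IH]; rewrite ?big_nil ?z1 // !big_cons g1 IH.
have s2 (s : seq 'I_n2) u : g u (\sum_(d <- s) Y j d *: w' d) =
    \sum_(d <- s) (Y j d)%:C%C * g u (w' d).
  by elim: s => [|d s IH]; rewrite ?big_nil ?z2 // !big_cons g2 IH.
rewrite s2 !mxE; apply: eq_bigr => d _; rewrite s1 !mxE mulrC; congr (_ * _).
by apply: eq_bigr => c _; rewrite !mxE.
Qed.

(** * Eigenvalues as products, and the resulting bounds *)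

(** The covector [l] is zero on [W k], where all the errors of the forms with [i + j = k] lie. The
    congruences for [b i j] thus become exact matrix equations for [B i j], to which
    [form_eigenvectors] applies. *)
Lemma quotient_eigenvalue_mul (R : realType) (V : vectType R)
    (W : nat -> {vspace V}) (A : 'End(V)) (r : nat)
    (b : nat -> nat -> V -> V -> V) (k : nat) (z : R[i]) :
  bracket_forms W A r b -> (forall i, (W i <= W i.+1)%VS) ->
  (forall i u, u \in W i -> A u \in W i) -> (k < r)%N ->
  quotient_eigenvalue (W k) (W k.+1) A z ->
  (forall j alpha, (j <= k)%N ->
    quotient_eigenvalue (flag_pred W j) (W j) A alpha -> alpha != 0) ->
  exists i j alpha beta, [/\ (i + j)%N = k, z = alpha * beta,
    quotient_eigenvalue (flag_pred W i) (W i) A alpha &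
    quotient_eigenvalue (flag_pred W j) (W j) A beta].
Proof.
move=> [lin1 lin2 memb predl predr equi gen] Wle AW kr [y y0 [Jy My]] nz.
pose l := functional y.
have lW := inclusion_functional Jy; have lA := restriction_functional My.
have pred_sub i : (flag_pred W i <= W i)%VS by case: i => [|i]; [exact: sub0v|exact: Wle].
have Apred i u : u \in flag_pred W i -> A u \in flag_pred W i.
  by case: i => [|i] /=; [rewrite !memv0 => /eqP ->; rewrite linear0|exact: AW].
pose B i j : 'M[R[i]]_(\dim (W i), \dim (W j)) :=
  \matrix_(c, d) l (b i j (vbasis (W i))`_c (vbasis (W j))`_d).
have g1 i j a u u' v : l (b i j (a *: u + u') v) =
    a%:C%C * l (b i j u v) + l (b i j u' v).
  by rewrite lin1 /l functional_linear.
have g2 i j a u v v' : l (b i j u (a *: v + v')) =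
    a%:C%C * l (b i j u v) + l (b i j u v').
  by rewrite lin2 /l functional_linear.
have BE i j m1 m2 (X : 'M[R]_(m1, \dim (W i))) (Y : 'M[R]_(m2, \dim (W j))) c d :=
  form_mx (nth 0 (vbasis (W i))) (nth 0 (vbasis (W j))) X Y c d (g1 i j) (g2 i j).
have incE i (c : 'I_(\dim (flag_pred W i))) :
    \sum_(e < \dim (W i)) inclusion_mx (flag_pred W i) (W i) c e *: (vbasis (W i))`_e
    = (vbasis (flag_pred W i))`_c.
  rewrite [RHS](coord_vbasis (subvP (pred_sub i) _ (mem_vbasis_nth c))).
  by apply: eq_bigr => e _; rewrite mxE.
have resE i (c : 'I_(\dim (W i))) :
    \sum_(e < \dim (W i)) restriction_mx (W i) A c e *: (vbasis (W i))`_e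
    = A (vbasis (W i))`_c.
  rewrite [RHS](coord_vbasis (AW _ _ (mem_vbasis_nth c))).
  by apply: eq_bigr => e _; rewrite mxE.
have oneE i (c : 'I_(\dim (W i))) :
    \sum_(e < \dim (W i)) (1%:M : 'M[R]_(\dim (W i))) c e *: (vbasis (W i))`_e
    = (vbasis (W i))`_c.
  rewrite (bigD1 c) //= mxE eqxx scale1r big1 ?addr0 // => e ec.
  by rewrite mxE eq_sym (negbTE ec) scale0r.
(* If all these matrices were zero, [l] would vanish on the brackets and on [W k], which together
   generate [W k.+1]. *)
have [i [j [ijk Bij]]] : exists i j, (i + j)%N = k /\ B i j != 0.
  apply/not_existsP => H.
  have B0 i j : (i + j)%N = k -> B i j = 0.
    move=> ijk; apply/eqP/negPn/negP => Bij; apply: (H i); by exists j.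
  move/eqP: y0; apply; apply: functional_eq0.
  apply: (gen k (fun w => l w = 0) kr) => [a u v lu lv|//|i j u v ijk ui vj].
    by rewrite /l functional_linear -!/(l _) lu lv mulr0 addr0.
  pose X : 'rV[R]_(\dim (W i)) := \row_c coord (vbasis (W i)) c u.
  pose Y : 'rV[R]_(\dim (W j)) := \row_c coord (vbasis (W j)) c v.
  have := BE i j _ _ X Y 0 0; rewrite -/(B i j) (B0 _ _ ijk) mulmx0 mul0mx mxE.
  rewrite (eq_bigr (fun c => coord (vbasis (W i)) c u *: (vbasis (W i))`_c)); last first.
    by move=> c _; rewrite mxE.
  rewrite -(coord_vbasis ui).
  rewrite (eq_bigr (fun c => coord (vbasis (W j)) c v *: (vbasis (W j))`_c)); last first.
    by move=> c _; rewrite mxE.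
  by rewrite -(coord_vbasis vj).
have ijr : (i + j < r)%N by rewrite ijk.
have JM2 : map_mx (real_complex R) (inclusion_mx (flag_pred W j) (W j)) *m
    map_mx (real_complex R) (restriction_mx (W j) A) =
    map_mx (real_complex R) (restriction_mx (flag_pred W j) A) *m
    map_mx (real_complex R) (inclusion_mx (flag_pred W j) (W j)).
  rewrite -!map_mxM inclusion_mx_restriction //; [exact: Apred|exact: AW].
(* Equivariance holds modulo [W k], on which [l] is zero, and [l] is an eigencovector for [z]. *)
have MB : map_mx (real_complex R) (restriction_mx (W i) A) *m B i j *m
    (map_mx (real_complex R) (restriction_mx (W j) A))^T = z *: B i j.
  apply/matrixP => c d; rewrite BE !resE [RHS]mxE [B i j c d]mxE.
  have uW := mem_vbasis_nth c; have vW := mem_vbasis_nth d.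
  have := equi _ _ _ _ ijr uW vW; rewrite ijk => /lW.
  rewrite addrC -scaleN1r functional_linear rmorphN rmorph1 mulN1r addrC.
  move/eqP; rewrite subr_eq0 => /eqP; rewrite -/(l _) => ->.
  by apply: lA; have := memb _ _ _ _ ijr uW vW; rewrite ijk.
have JB : map_mx (real_complex R) (inclusion_mx (flag_pred W i) (W i)) *m B i j = 0.
  apply/matrixP => c d; have := BE i j _ _ (inclusion_mx (flag_pred W i) (W i)) 1%:M c d.
  rewrite map_mx1 trmx1 mulmx1 => ->; rewrite incE oneE mxE; apply: lW.
  by rewrite -ijk; apply: (predl _ _ _ _ ijr); exact: mem_vbasis_nth.
have BJ : B i j *m (map_mx (real_complex R) (inclusion_mx (flag_pred W j) (W j)))^T = 0.
  apply/matrixP => c d; have := BE i j _ _ 1%:M (inclusion_mx (flag_pred W j) (W j)) c d.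
  rewrite map_mx1 mul1mx => ->; rewrite incE oneE mxE; apply: lW.
  by rewrite -ijk; apply: (predr _ _ _ _ ijr); exact: mem_vbasis_nth.
have [beta [qb [x x0 [Jx Mx]]]] := form_eigenvectors JM2 Bij MB JB BJ.
have b0 : beta != 0 by apply: (nz j) qb; rewrite -ijk leq_addl.
(* The column [x] satisfies [beta *: (M1 *m x) = z *: x], where [M1] is the restriction matrix on
   [W i]; dividing by [beta] makes it an eigencovector for [z / beta]. *)
exists i, j, (z / beta), beta; split=> //; first by rewrite divfK.
exists x => //; split=> //; rewrite mulrC -scalerA -Mx scalerA mulVf //.
by rewrite scale1r.
Qed.

(** Nonvanishing is proved along with the bounds: it allows the division that splits the eigenvalues
    of the next level, and the logarithm of the product. The factor [i.+1] is additive in the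
    splitting: [k.+2 = i.+1 + j.+1] when [i + j = k]. *)
Lemma quotient_eigenvalue_bounds (R : realType) (V : vectType R)
    (W : nat -> {vspace V}) (A : 'End(V)) (r : nat)
    (b : nat -> nat -> V -> V -> V) (lo hi : R) :
  bracket_forms W A r b -> (forall i, (W i <= W i.+1)%VS) ->
  (forall i u, u \in W i -> A u \in W i) -> (A @: W 0%N)%VS = W 0%N ->
  (forall z, quotient_eigenvalue 0 (W 0%N) A z -> lo <= ln (Normc.normc z) <= hi) ->
  forall i z, (i <= r)%N -> quotient_eigenvalue (flag_pred W i) (W i) A z ->
  z != 0 /\ i.+1%:R * lo <= ln (Normc.normc z) <= i.+1%:R * hi.
Proof.
move=> bf Wle AW AW0 base i; elim/ltn_ind: i => -[|k] IH z kr /=.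
  move=> qz; split; last by rewrite !mul1r; exact: base.
  (* An eigencovector for [0] would vanish on the image of [W 0], which is all of [W 0]. *)
  case: qz => y y0 [_ My]; apply: contra_neq y0 => z0.
  apply: functional_eq0 => w wW; have : w \in (A @: W 0%N)%VS by rewrite AW0.
  move=> /memv_imgP[u uW ->].
  by rewrite (restriction_functional My uW) z0 mul0r.
move=> qz; have nz j alpha : (j <= k)%N ->
    quotient_eigenvalue (flag_pred W j) (W j) A alpha -> alpha != 0.
  by move=> jk /(IH _ _ _ (leq_trans jk (ltnW kr)))[].
have [i [j [alpha [beta [ijk -> qa qb]]]]] :=
  quotient_eigenvalue_mul bf Wle AW kr qz nz.
have ik : (i <= k)%N by rewrite -ijk leq_addr.
have jk : (j <= k)%N by rewrite -ijk leq_addl.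
have [a0 /andP[la ua]] := IH i ik alpha (leq_trans ik (ltnW kr)) qa.
have [b0 /andP[lb ub]] := IH j jk beta (leq_trans jk (ltnW kr)) qb.
have pos (w : R[i]) : w != 0 -> Normc.normc w \is Num.pos.
  move=> w0; rewrite posrE lt0r; apply/andP; split.
    by apply: contra w0 => /eqP/Normc.eq0_normc ->.
  by case: w {w0} => u v; exact: sqrtr_ge0.
split; first by rewrite mulf_neq0.
rewrite Normc.normcM lnM ?pos //.
have -> : k.+2 = (i.+1 + j.+1)%N by rewrite addSn addnS ijk.
by rewrite natrD !mulrDl !lerD.
Qed.

(** * Exponents by blocks and conclusion *)

(** The inclusion of [E p] in the flag requires vectors of [E p] to extend to local sections of [E];
    a local frame extends a basis, and the span does the rest. *)
Lemma flag0 (R : realType) n (M : manifold R n) (E : M -> {vspace 'rV[R]_n})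
    (p : M) : smooth_subbundle setT E -> flag E 0 p = E p.
Proof.
move=> Es; apply/eqP; rewrite eqEsubv; apply/andP; split; apply/subvP.
  apply: (@set_span_ind _ _ _ (fun v => v \in E p)).
  - exact: mem0v.
  - by move=> a u v Hu Hv; rewrite memvD ?memvZ.
  move=> _ [U [k [X [Uo Up + HX ->]]]]; case: HX => // {k X} X [_ XE] _.
  exact: XE.
move=> v; have [V [k [F [Vo Vp Fs Fb]]]] := Es p I.
have /andP[/eqP <- _] := Fb p Vp; move: v; apply/subvP/span_subvP => v.
move=> /codomP[i ->]; apply: (mem_flag Vo Vp (leqnn _)).
apply: iterated_bracket0; split; first exact: Fs.
move=> y Vy; have /andP[/eqP <- _] := Fb y Vy.
exact: memv_span (codom_f (F^~ y) i).
Qed.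

Theorem theorem1p2 (R : realType) (n : nat) (N : subRiemannian R n)
    (f : N -> N) (p : N) (r : nat) (lambda : nat -> R)
    (f_diffeo : local_diffeomorphism f)
    (f_horizontal : preserves_horizontal f)
    (p_generic : generic_at (@horizontal R n N) r p)
    (f_fixed : f p = p)
    (p_step : tangent_cone_step p r.+1)
    (lambda_gt0 : forall j : nat, (0 < j <= flag_dim p r.+1)%N -> 0 < lambda j)
    (f_exponents : forall i : nat, (i <= r)%N ->
      lyapunov_exponents (flag (@horizontal R n N) i p) (tangent_map f p)
        [seq ln (lambda j) | j <- iota 1 (flag_dim p i.+1)])
    (f_sorted : forall i : nat, (i <= r)%N ->
      forall j k : nat, (flag_dim p i < j)%N -> (j <= k)%N ->
        (k <= flag_dim p i.+1)%N -> ln (lambda j) <= ln (lambda k)) :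
  forall i : nat, (i <= r)%N ->
  forall j : nat, (flag_dim p i < j <= flag_dim p i.+1)%N ->
    i.+1%:R * ln (lambda 1%N) <= ln (lambda j) <=
      i.+1%:R * ln (lambda (flag_dim p 1)).
Proof.
pose E := @horizontal R n N; pose W i := flag E i p.
have fE x : (tangent_map f x @: E x <= E (f x))%VS by rewrite f_horizontal.
have [AW [b bf]] := exists_bracket_forms p_generic f_diffeo fE f_fixed.
have Wle i : (W i <= W i.+1)%VS by exact: flag_subv.
have AW0 : (tangent_map f p @: W 0%N)%VS = W 0%N.
  rewrite /W (flag0 p (@horizontal_smooth R n N)) f_horizontal.
  by rewrite f_fixed.
have dimE i : flag_dim p i = \dim (flag_pred W i) by case: i => [|i] //=; rewrite dimv0.
have le_dim i : (flag_dim p i <= flag_dim p i.+1)%N.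
  by rewrite dimE; case: i => [|i]; [rewrite dimv0|apply: dimvS; exact: Wle].
(* These are the positions n_(i-1)+1 to n_i: what remains of the exponents on E^i_p once those on
   E^(i-1)_p are removed from the front. *)
pose block i := [seq ln (lambda j) | j <- iota (flag_dim p i).+1
  (flag_dim p i.+1 - flag_dim p i)].
have quot i : (i <= r)%N ->
    exists2 nu : seq R[i], perm_eq (block i) [seq ln (Normc.normc z) | z <- nu] &
      forall z, z \in nu <->
        quotient_eigenvalue (flag_pred W i) (W i) (tangent_map f p) z.
  move=> ir; apply: (lyapunov_exponents_quotient
    (s := [seq ln (lambda j) | j <- iota 1 (flag_dim p i)])).
  - by case: i ir => [|i] _; [exact: sub0v|exact: Wle].
  - case: i ir => [|i] _ u /=; last exact: AW.
    by rewrite memv0 => /eqP ->; rewrite linear0 mem0v.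
  - exact: AW.
  - case: i ir => [|i] ir /=; first exact: lyapunov_exponents0.
    exact: f_exponents (ltnW ir).
  - rewrite /block -map_cat -[(flag_dim p i).+1]add1n -iotaD subnKC //.
    exact: f_exponents.
have mem_block i j : ((flag_dim p i < j <= flag_dim p i.+1)%N) =
    (j \in iota (flag_dim p i).+1 (flag_dim p i.+1 - flag_dim p i)).
  by rewrite mem_iota addSn subnKC // ltnS.
have base z : quotient_eigenvalue 0 (W 0%N) (tangent_map f p) z ->
    ln (lambda 1%N) <= ln (Normc.normc z) <= ln (lambda (flag_dim p 1)).
  have [nu nuP nuE] := quot 0%N (leq0n r).
  move=> /(nuE z) znu; have : ln (Normc.normc z) \in block 0%N.
    by rewrite (perm_mem nuP); apply/mapP; exists z.
  move=> /mapP[j]; rewrite -mem_block => /andP[j0 jn] ->.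
  (* The exponents on E_p occupy the positions 1 to n_0, and this block is sorted, so its two ends
     bound it. *)
  by rewrite !(f_sorted 0%N) // (leq_trans j0 jn).
move=> i ir j; rewrite mem_block => jB.
have [nu nuP nuE] := quot i ir.
have : ln (lambda j) \in [seq ln (Normc.normc z) | z <- nu].
  by rewrite -(perm_mem nuP); apply/mapP; exists j.
move=> /mapP[z /(nuE z) qz ->].
by have [] := quotient_eigenvalue_bounds bf Wle AW AW0 base ir qz.
Qed.
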